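(* Let $\gamma>0$ and $T>0$. For $H\in(0,1]$ let $B_H=\{B_H(t):t\ge 0\}$ be a fractional Brownian motion with Hurst parameter $H$, and let $$K_T(H,\gamma):=\mathbb{E}\left[\left(\sup_{t\in[0,T]}|B_H(t)|\right)^{\gamma}\right].$$ (i) If $0<H<1/2$, then $$K_T(H,\gamma)\ \ge\ T^{\gamma H}\,\frac{1}{\sqrt{\pi}}\,2^{\frac{\gamma}{2}}\,\Gamma\left(\frac{\gamma+1}{2}\right).$$ (ii) If $1/2\le H\le 1$, then $$T^{\gamma H}\,\frac{1}{\sqrt{\pi}}\,2^{\frac{\gamma}{2}}\,\Gamma\left(\frac{\gamma+1}{2}\right)\ \le\ K_T(H,\gamma)\ \le\ T^{\gamma H}\,\frac{1}{\sqrt{\pi}}\,2^{\frac{\gamma}{2}+1}\,\Gamma\left(\frac{\gamma+1}{2}\right).$$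
   Context: A fractional Brownian motion with Hurst parameter $H\in(0,1]$ is a centered Gaussian process $\{B_H(t):t\ge0\}$ with stationary increments and variance function $\mathrm{Var}(B_H(t))=t^{2H}$ (so $B_H(0)=0$ a.s.); as usual, it is taken with continuous sample paths. $\Gamma$ denotes the Euler Gamma function. *)

(* Defs.v *)
From HB Require Import structures.
From mathcomp Require Import all_boot all_order all_algebra.
From mathcomp Require Import all_classical all_reals all_analysis.

Set Implicit Arguments.
Unset Strict Implicit.
Unset Printing Implicit Defensive.

Import Order.TTheory GRing.Theory Num.Theory.
Import numFieldNormedType.Exports.

Local Open Scope classical_set_scope.
Local Open Scope ring_scope.

Definition Gamma (R : realType) (x : R) : R :=
  \int[@lebesgue_measure R]_(t in `]0, +oo[) (t `^ (x - 1) * expR (- t)).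

(* Degenerate laws are included. The case s = 0 is separate because the
   library's [normal_prob m 0] is the uniform law on [0, 1], not [\d_m].
   Measures are compared on measurable sets only, since their values elsewhere
   are unspecified. *)
Definition gaussian_rv (d : measure_display) (Omega : measurableType d)
    (R : realType) (P : probability Omega R) (X : Omega -> R) : Prop :=
  exists m s : R, 0 <= s /\
    forall A : set R, measurable A ->
      pushforward P X A = if s == 0 then \d_m A else normal_prob m s A.

(* Processes are indexed by R, but only their values at times t >= 0 matter. *)

Definition gaussian_process (d : measure_display) (Omega : measurableType d)
    (R : realType) (P : probability Omega R) (B : R -> {RV P >-> R}) : Prop :=
  forall (n : nat) (t a : 'I_n -> R), (forall i, 0 <= t i) ->
    gaussian_rv P (fun w => \sum_(i < n) a i * B (t i) w).

Definition same_fdd (d : measure_display) (Omega : measurableType d)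
    (R : realType) (P : probability Omega R) (X Y : R -> Omega -> R) : Prop :=
  forall (n : nat) (t : 'I_n -> R), (forall i, 0 <= t i) ->
    forall A : set (n.-tuple R), measurable A ->
      pushforward P (fun w => [tuple X (t i) w | i < n]) A =
      pushforward P (fun w => [tuple Y (t i) w | i < n]) A.

Definition stationary_increments (d : measure_display)
    (Omega : measurableType d) (R : realType) (P : probability Omega R)
    (B : R -> {RV P >-> R}) : Prop :=
  forall h : R, 0 <= h ->
    same_fdd P (fun t w => B (t + h) w - B h w) (fun t w => B t w - B 0 w).

Record fractional_brownian_motion (d : measure_display)
    (Omega : measurableType d) (R : realType) (P : probability Omega R)
    (H : R) (B : R -> {RV P >-> R}) : Prop := {
  fbm_gaussian : gaussian_process B ;
  fbm_centered : forall t : R, 0 <= t -> ('E_P[B t] = 0)%E ;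
  fbm_stationary : stationary_increments B ;
  fbm_variance : forall t : R, 0 <= t -> ('V_P[B t] = (t `^ (2 * H))%:E)%E ;
  fbm_continuous : forall w, {within `[0, +oo[, continuous (fun t : R => B t w)}
}.

(* The real-valued [sup] is the true supremum when paths are continuous. *)
Definition sup_moment (d : measure_display) (Omega : measurableType d)
    (R : realType) (P : probability Omega R) (B : R -> {RV P >-> R})
    (T gamma : R) : \bar R :=
  'E_P[fun w => ((sup [set `|B t w| | t in `[0, T]]) `^ gamma)%R]%E.

(* Main.v *)
Require Import Defs.
From HB Require Import structures.
From mathcomp Require Import all_boot all_order all_algebra.
From mathcomp Require Import all_classical all_reals all_analysis.
From mathcomp Require Import measurable_realfun.
From mathcomp Require Import ring lra.
Set Implicit Arguments.
Unset Strict Implicit.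
Unset Printing Implicit Defensive.
Import Order.TTheory GRing.Theory Num.Theory.
Import numFieldNormedType.Exports.
Local Open Scope classical_set_scope.
Local Open Scope ring_scope.

(** The constant is the absolute moment of a standard normal variable N:
    [integral_N01_norm_powR] computes E|N|^gamma by the substitution
    y = sqrt(2t), and since B_T is centered Gaussian with standard deviation
    T^H, E|B_T|^gamma is T^(gamma H) times it ([fbm_norm_moment]).  The lower
    bound follows from sup|B| >= |B_T|.  The upper bound for H >= 1/2 says
    that E sup|B|^gamma <= 2 E|B_T|^gamma.

    It comes from the tail estimate P(max_i X_i > u) <= 2 P(X_n > v), v < u,
    for the values X_i = B(t_i) on a finite grid ending at t_n = T.  For a
    Gaussian random walk Y with Var Y_i = t_i^(2H) this is the reflection
    inequality ([gaussian_walk]).  The covariance of Y is min(s,t)^(2H), whereas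
    that of B is half of s^(2H) + t^(2H) - |t-s|^(2H); as x^(2H) is superadditive for 2H >= 1, the
    latter is the larger one ([fbm_cov_ge]).  Hence B is at least as positively
    correlated as Y with the same variances, and by Slepian's inequality
    ([slepian]) its maximum is stochastically smaller.  Adding the estimates
    for X and -X costs nothing, because X_n > v and - X_n > v are disjoint
    events when v >= 0.  Integrating the tails gives the moment inequality on
    each grid ([gauss_max_moment]), and the maxima over dyadic grids increase
    to the supremum by continuity of the paths, so that monotone convergence
    concludes.

    Slepian's inequality is proved by interpolation.  Let f be a product of
    identical decreasing steps h(x_k), close to the indicator of the event that
    all x_k <= u.  Along sqrt(1-t) X + sqrt(t) Y, with X and Y independent, the
    derivative of E f is half the sum of (Cov_Y - Cov_X)_ij E d_i d_j f, whose
    diagonal terms vanish and whose other terms are nonpositive since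
    d_i d_j f is h'(x_i) h'(x_j) times a product of values of h.  The steps are
    chosen to be trigonometric polynomials.  All expectations are then finite
    combinations of E cos(a.X + b), which are explicit for Gaussian vectors, including
    degenerate ones, and the interpolation identity becomes the differentiation
    of a finite sum.  The price is that a periodic h decreases only on a
    bounded interval; the error is controlled by the tails of X and Y, because
    the period can be taken large while the slope of h stays bounded
    ([soft_step_exists]). *)

(** * Derivatives of real functions *)

Section pointwise_derivatives.
Variable R : realType.
Implicit Types (f g : R -> R) (x c df dg : R).

Lemma is_derive1_eq f x df df' :
  is_derive x 1 f df -> df = df' -> is_derive x 1 f df'.
Proof. by move=> ? <-. Qed.

Lemma is_derive_fcst c x : is_derive x 1 (fun=> c : R) 0.
Proof. exact: is_derive_cst. Qed.

Lemma is_derive_fid x : is_derive x 1 (fun y : R => y) 1.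
Proof. exact: is_derive_id. Qed.

Lemma is_derive_fD f g x df dg :
  is_derive x 1 f df -> is_derive x 1 g dg ->
  is_derive x 1 (fun y => f y + g y) (df + dg).
Proof. exact: is_deriveD. Qed.

Lemma is_derive_fN f x df :
  is_derive x 1 f df -> is_derive x 1 (fun y => - f y) (- df).
Proof. exact: is_deriveN. Qed.

Lemma is_derive_fM f g x df dg :
  is_derive x 1 f df -> is_derive x 1 g dg ->
  is_derive x 1 (fun y => f y * g y) (df * g x + f x * dg).
Proof.
move=> hf hg; have -> : df * g x + f x * dg = f x *: dg + g x *: df.
  by rewrite /GRing.scale/= addrC; congr (_ + _); rewrite mulrC.
exact: is_deriveM.
Qed.

Lemma is_derive_fX f n x df : is_derive x 1 f df ->
  is_derive x 1 (fun y => f y ^+ n) (n%:R * f x ^+ n.-1 * df).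
Proof. by move=> hf; have := is_deriveX n hf; rewrite exprfctE. Qed.

Lemma is_derive_fsin f x df : is_derive x 1 f df ->
  is_derive x 1 (fun y => sin (f y)) (cos (f x) * df).
Proof. by move=> hf; apply: (@is_derive1_comp _ sin f). Qed.

Lemma is_derive_fcos f x df : is_derive x 1 f df ->
  is_derive x 1 (fun y => cos (f y)) (- sin (f x) * df).
Proof. by move=> hf; apply: (@is_derive1_comp _ cos f). Qed.

Lemma is_derive_fexpR f x df : is_derive x 1 f df ->
  is_derive x 1 (fun y => expR (f y)) (expR (f x) * df).
Proof. by move=> hf; apply: (@is_derive1_comp _ expR f). Qed.

Lemma is_derive_bigsum (I : Type) (r : seq I) (F : I -> R -> R) (dF : I -> R) x :
  (forall i, is_derive x 1 (F i) (dF i)) ->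
  is_derive x 1 (fun y => \sum_(i <- r) F i y) (\sum_(i <- r) dF i).
Proof.
move=> h; elim: r => [|i r IH].
  rewrite big_nil [X in is_derive _ _ X](_ : _ = fun=> 0).
    exact: is_derive_fcst.
  by apply/funext => y; rewrite big_nil.
rewrite big_cons [X in is_derive _ _ X](_ : _ =
    fun y => F i y + \sum_(j <- r) F j y).
  exact: is_derive_fD.
by apply/funext => y; rewrite big_cons.
Qed.

End pointwise_derivatives.

(** Syntax-directed, so that constants such as [bump_primitive] are never
   unfolded in search of a sum or a product. *)
Ltac derive_rec :=
  lazymatch goal with
  | |- is_derive _ _ (fun=> ?c) _ => exact: is_derive_fcst
  | |- is_derive _ _ (fun y => y) _ => exact: is_derive_fid
  | |- is_derive _ _ (fun y => @?f y + @?g y) _ =>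
      notypeclasses refine (@is_derive_fD _ f g _ _ _ _ _); derive_rec
  | |- is_derive _ _ (fun y => - @?f y) _ =>
      notypeclasses refine (@is_derive_fN _ f _ _ _); derive_rec
  | |- is_derive _ _ (fun y => @?f y * @?g y) _ =>
      notypeclasses refine (@is_derive_fM _ f g _ _ _ _ _); derive_rec
  | |- is_derive _ _ (fun y => @?f y ^+ ?n) _ =>
      notypeclasses refine (@is_derive_fX _ f n _ _ _); derive_rec
  | |- is_derive _ _ (fun y => sin (@?f y)) _ =>
      notypeclasses refine (@is_derive_fsin _ f _ _ _); derive_rec
  | |- is_derive _ _ (fun y => cos (@?f y)) _ =>
      notypeclasses refine (@is_derive_fcos _ f _ _ _); derive_rec
  | |- is_derive _ _ (fun y => expR (@?f y)) _ =>
      notypeclasses refine (@is_derive_fexpR _ f _ _ _); derive_rec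
  | _ => eassumption
  end.

Ltac derive := eapply is_derive1_eq; [derive_rec|cbv beta].

(** * Trigonometric step functions *)

Lemma is_derive_nondecreasing (R : realType) (f df : R -> R) (a b : R) :
  (forall x : R, is_derive x 1 f (df x)) ->
  (forall x, a <= x <= b -> 0 <= df x) -> a <= b -> f a <= f b.
Proof.
move=> fdf df0 ab.
have cf : {within `[a, b], continuous f}.
  apply: continuous_subspaceT => x; apply: differentiable_continuous.
  by apply/derivable1_diffP; have [] := fdf x.
have [c] := MVT_segment ab (fun x _ => fdf x) cf.
rewrite in_itv/= => cab fE; rewrite -subr_ge0 fE mulr_ge0 ?subr_ge0//.
exact: df0.
Qed.

(** The integral of (1 - r^2)^m from 0 to s, by the recursion that integration by
    parts gives; it is a polynomial in s, hence a trigonometric polynomial when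
    s is a sine. *)
Fixpoint bump_primitive (R : realType) (m : nat) (s : R) : R :=
  if m is m'.+1 then
    (s * (1 - s ^+ 2) ^+ m + (2 * m)%:R * bump_primitive m' s) / (2 * m).+1%:R
  else s.

Section bump_primitive.
Variable R : realType.
Implicit Types (m : nat) (s : R).
Local Notation Q := (@bump_primitive R).

Lemma is_derive_bump_primitive m s : is_derive s 1 (Q m) ((1 - s ^+ 2) ^+ m).
Proof.
elim: m => [|m IH]; first by rewrite expr0; exact: is_derive_id.
have -> : Q m.+1 = fun x => (x * (1 - x ^+ 2) ^+ m.+1 +
    (2 * m.+1)%:R * Q m x) * (2 * m.+1).+1%:R^-1 by [].
derive; rewrite /= !exprS.
have E : (2 * m.+1)%:R = 2 * (m%:R + 1) :> R by rewrite natrM natr1.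
have F : (2 * m.+1).+1%:R = 2 * (m%:R + 1) + 1 :> R by rewrite -natr1 E.
have : (2 * m.+1).+1%:R != 0 :> R by rewrite pnatr_eq0.
rewrite F E -(@natr1 R m) => H; field.
by [].
Qed.

Lemma bump_primitive_mono m s t : -1 <= s -> s <= t -> t <= 1 -> Q m s <= Q m t.
Proof.
move=> s1 st t1; apply: (is_derive_nondecreasing (is_derive_bump_primitive m)) => //.
by move=> x /andP[sx xt]; apply: exprn_ge0; nra.
Qed.

Lemma bump_primitiveN m s : Q m (- s) = - Q m s.
Proof.
by elim: m => [//|m /= ->]; rewrite sqrrN mulNr mulrN -opprD mulNr.
Qed.

Lemma bump_primitive0 m : Q m 0 = 0.
Proof. by elim: m => [//|m /= ->]; rewrite mul0r mulr0 addr0 mul0r. Qed.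

Lemma bump_primitive1S m : Q m.+1 1 = (2 * m.+1)%:R / (2 * m.+1).+1%:R * Q m 1.
Proof. by rewrite /= expr1n subrr exprS mul0r mulr0 add0r mulrAC. Qed.

Lemma bump_primitive1_gt0 m : 0 < Q m 1.
Proof.
elim: m => [|m IH]; first exact: ltr01.
by rewrite bump_primitive1S mulr_gt0// divr_gt0.
Qed.

(** The sequence (2m+1) Q_m(1)^2 is nondecreasing in m, since
    (2m+2)^2 >= (2m+1)(2m+3).  As the slope of the step below is inversely
    proportional to the total mass, this bounds that slope. *)
Lemma bump_primitive1_lb m : 1 <= (2 * m).+1%:R * Q m 1 ^+ 2.
Proof.
elim: m => [|m IH]; first by rewrite muln0 expr1n mulr1.
rewrite bump_primitive1S !exprMn exprVn; move: IH; move: (Q m 1 ^+ 2) => q.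
have E : (2 * m.+1)%:R = 2 * (m%:R + 1) :> R by rewrite natrM natr1.
have F : (2 * m.+1).+1%:R = 2 * (m%:R + 1) + 1 :> R by rewrite -natr1 E.
have G : (2 * m).+1%:R = 2 * m%:R + 1 :> R by rewrite -natr1 natrM.
rewrite F E G; have : 0 <= m%:R :> R by []; move: (m%:R) => {E F G m} x x0 qx.
have -> : (2 * (x + 1) + 1) * ((2 * (x + 1)) ^+ 2 / (2 * (x + 1) + 1) ^+ 2 * q)
    = (2 * (x + 1)) ^+ 2 * q / (2 * (x + 1) + 1) by field; apply/eqP; lra.
rewrite ler_pdivlMr; last lra.
have : 1 / (2 * x + 1) <= q by rewrite ler_pdivrMr; lra.
move=> h; apply: le_trans (_ : (2 * (x + 1)) ^+ 2 * (1 / (2 * x + 1)) <= _).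
  rewrite mulrA ler_pdivlMr; nra.
by rewrite ler_wpM2l// sqr_ge0.
Qed.

(** Chebyshev's inequality for the mass of (1 - r^2)^m on [s, 1]; the second
    moment is the difference of two consecutive total masses. *)
Lemma bump_primitive_tail m s : 0 <= s <= 1 ->
  s ^+ 2 * (Q m 1 - Q m s) <= Q m 1 / (2 * m.+1).+1%:R.
Proof.
move=> /andP[s0 s1].
have dW (t : R) : is_derive t 1 (fun r => Q m r - Q m.+1 r)
    (t ^+ 2 * (1 - t ^+ 2) ^+ m).
  have dm := is_derive_bump_primitive m t.
  have dS := is_derive_bump_primitive m.+1 t.
  by derive; rewrite (exprS _ m); ring.
have W0 : 0 <= Q m s - Q m.+1 s.
  rewrite [leLHS](_ : 0 = Q m 0 - Q m.+1 0); last first.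
    by rewrite !bump_primitive0 subrr.
  apply: (is_derive_nondecreasing dW) => // x /andP[x0 xs].
  apply: mulr_ge0; first exact: sqr_ge0.
  by apply: exprn_ge0; nra.
have dg (t : R) : is_derive t 1 (fun r => Q m r - Q m.+1 r - s ^+ 2 * Q m r)
    ((t ^+ 2 - s ^+ 2) * (1 - t ^+ 2) ^+ m).
  have dm := is_derive_bump_primitive m t.
  have dS := is_derive_bump_primitive m.+1 t.
  by derive; rewrite (exprS _ m); ring.
have : Q m s - Q m.+1 s - s ^+ 2 * Q m s <= Q m 1 - Q m.+1 1 - s ^+ 2 * Q m 1.
  apply: (is_derive_nondecreasing dg) => // x /andP[sx x1].
  apply: mulr_ge0; first by rewrite subr_ge0 ler_sqr ?nnegrE//; lra.
  by apply: exprn_ge0; nra.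
have -> : Q m 1 / (2 * m.+1).+1%:R = Q m 1 - Q m.+1 1.
  rewrite bump_primitive1S.
  have : (2 * m.+1).+1%:R != 0 :> R by rewrite pnatr_eq0.
  have -> : (2 * m.+1)%:R = (2 * m.+1).+1%:R - 1 :> R.
    by rewrite -(@natr1 R (2 * m.+1)) addrK.
  by move: (_.+1%:R) => k k0; field.
nra.
Qed.

End bump_primitive.

Section soft_step.
Variable R : realType.
Local Notation Q := (@bump_primitive R).

(** It decreases from 1 to 0 as x runs over [-L pi/2, L pi/2], by integrating a
    power of the cosine of x / L. *)
Definition soft_step (m : nat) (L x : R) : R :=
  2^-1 - (2 * Q m 1)^-1 * Q m (sin (x / L)).

Definition soft_step' (m : nat) (L x : R) : R :=
  - ((2 * Q m 1 * L)^-1 * cos (x / L) ^+ (2 * m).+1).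

Lemma is_derive_soft_step m L (x : R) :
  is_derive x 1 (soft_step m L) (soft_step' m L x).
Proof.
have dQ : is_derive x 1 (fun y => Q m (sin (y / L)))
    ((1 - sin (x / L) ^+ 2) ^+ m * (cos (x / L) * L^-1)).
  apply: (@is_derive1_comp _ (Q m) (fun y => sin (y / L))).
    exact: is_derive_bump_primitive.
  by derive; rewrite mul1r mulr0 addr0.
rewrite /soft_step; derive; rewrite /soft_step' -cos2sin2 -exprM (exprS _ (2 * m)) !invfM.
ring.
Qed.

Lemma sin_ge_linear (z : R) : 0 <= z <= 1 -> cos 1 * z <= sin z.
Proof.
move=> /andP[z0 z1]; rewrite -subr_ge0.
have -> : 0 = sin 0 - cos 1 * 0 :> R by rewrite sin0 mulr0 subrr.
have D (t : R) : is_derive t 1 (fun t => sin t - cos 1 * t) (cos t - cos 1).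
  by derive; ring.
apply: (is_derive_nondecreasing D) => // t /andP[t0 tz].
have t1 := le_trans tz z1.
have pi1 := le_trans (ler1n R 2) (@pi_ge2 R).
have [->|t1'] := eqVneq t 1; first by rewrite subrr.
have tl1 : t < 1 by rewrite lt_neqAle t1'.
by rewrite subr_ge0 ltW// ltr_cos ?in_itv/= ?t0 ?ler01 ?ler0n ?(le_trans t1)//; lra.
Qed.

Section bounds.
Variables (m : nat) (L : R).
Hypothesis L_gt0 : 0 < L.

Let Q1 : 0 < Q m 1. Proof. exact: bump_primitive1_gt0. Qed.

Lemma bump_primitive_sin_bound (y : R) : `|Q m (sin y)| <= Q m 1.
Proof.
have [q1 l0] := (Q1, L_gt0).
rewrite ler_norml -bump_primitiveN.
by apply/andP; split; apply: bump_primitive_mono; rewrite ?sin_geN1 ?sin_le1.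
Qed.

Lemma soft_step_itv01 x : 0 <= soft_step m L x <= 1.
Proof.
have [q1 l0] := (Q1, L_gt0).
have := bump_primitive_sin_bound (x / L).
have h0 : 0 < (2 * Q m 1)^-1 by rewrite invr_gt0; lra.
have h1 : (2 * Q m 1)^-1 * Q m 1 = 2^-1.
  by rewrite invfM -mulrA mulVf ?mulr1// gt_eqF.
by rewrite ler_norml /soft_step; move: (Q m (sin _)) => q /andP[? ?]; nra.
Qed.

Lemma soft_step'_bound x :
  `|soft_step' m L x| <= Num.sqrt (2 * m).+1%:R / (2 * L).
Proof.
have [q1 l0] := (Q1, L_gt0).
rewrite /soft_step' normrN normrM normrX ger0_norm; last first.
  by rewrite invr_ge0 !mulr_ge0 ?ltW.
have : `|cos (x / L)| ^+ (2 * m).+1 <= 1 by rewrite exprn_ile1// cos_max.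
move=> c1; apply: le_trans (_ : (2 * Q m 1 * L)^-1 * 1 <= _).
  by rewrite ler_wpM2l// invr_ge0 !mulr_ge0 ?ltW.
have h : 1 <= Num.sqrt (2 * m).+1%:R * Q m 1.
  rewrite -ler_sqr ?nnegrE ?mulr_ge0 ?sqrtr_ge0 ?(ltW q1)//.
  by rewrite exprMn expr1n sqr_sqrtr ?ler0n// bump_primitive1_lb.
rewrite mulr1 ler_pdivlMr; last lra.
have -> : (2 * Q m 1 * L)^-1 * (2 * L) = 1 / Q m 1 by field; rewrite !gt_eqF.
by rewrite ler_pdivrMr.
Qed.

Lemma soft_step'_le0 x : `|x| <= L -> soft_step' m L x <= 0.
Proof.
have [q1 l0] := (Q1, L_gt0).
move=> xL; rewrite /soft_step' oppr_le0 mulr_ge0//.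
  by rewrite invr_ge0 !mulr_ge0 ?ltW.
apply: exprn_ge0; apply: cos_ge0_pihalf.
rewrite -ler_norml normrM normfV (gtr0_norm L_gt0).
have : `|x| / L <= 1 by rewrite ler_pdivrMr// mul1r.
by have := @pihalf_ge1 R; lra.
Qed.

(** Beyond e the argument sin(x / L) is at least cos 1 * (e / L), so the tail bound
    applies. *)
Lemma soft_step_small (e x : R) : 0 < e -> e <= x -> x <= L ->
  soft_step m L x <= L ^+ 2 / ((2 * m.+1).+1%:R * (cos 1 * e) ^+ 2).
Proof.
have [q1 l0] := (Q1, L_gt0).
move=> e0 ex xL.
pose s : R := cos 1 * (e / L).
have eL1 : 0 <= e / L <= 1.
  by rewrite divr_ge0 ?(ltW L_gt0) ?(ltW e0)// ler_pdivrMr// mul1r (le_trans ex).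
have c1 := @cos1_gt0 R.
have sx : s <= sin (x / L).
  apply: le_trans (sin_ge_linear eL1) _.
  have pi1 := @pihalf_ge1 R.
  have eLx : e / L <= x / L by rewrite ler_wpM2r// invr_ge0 ltW.
  have xL1 : x / L <= 1 by rewrite ler_pdivrMr ?mul1r.
  have [->//|ne] := eqVneq (e / L) (x / L).
  have lt : e / L < x / L by rewrite lt_neqAle ne.
  case/andP: eL1 => eL0 eL1.
  by rewrite ltW// ltr_sin ?in_itv/=//; apply/andP; split; lra.
have s0 : 0 < s by rewrite mulr_gt0 ?divr_gt0.
have s1 : s <= 1 by rewrite (le_trans sx)// sin_le1.
have Qs : Q m s <= Q m (sin (x / L)).
  by apply: bump_primitive_mono; rewrite ?sin_le1//; lra.
have := @bump_primitive_tail R m s; rewrite (ltW s0) s1 => /(_ isT) tail.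
have -> : L ^+ 2 / ((2 * m.+1).+1%:R * (cos 1 * e) ^+ 2) =
   ((2 * m.+1).+1%:R)^-1 / s ^+ 2.
  rewrite /s; have : (2 * m.+1).+1%:R != 0 :> R by rewrite pnatr_eq0.
  move: (_%:R) => k k0; field.
  by rewrite k0 !gt_eqF.
have -> : soft_step m L x = (Q m 1 - Q m (sin (x / L))) / (2 * Q m 1).
  rewrite /soft_step; move: (Q m (sin _)) => q; field.
  by rewrite gt_eqF.
have s20 : 0 < s ^+ 2 by rewrite exprn_gt0.
have q20 : 0 < 2 * Q m 1 by lra.
rewrite ler_pdivlMr// mulrAC ler_pdivrMr//.
have : (Q m 1 - Q m (sin (x / L))) * s ^+ 2 <= Q m 1 / (2 * m.+1).+1%:R.
  by apply: le_trans tail; rewrite mulrC ler_wpM2l ?(ltW s20)//; lra.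
move: ((2 * m.+1).+1%:R)^-1 (invr_ge0 ((2 * m.+1).+1%:R : R)) => k.
rewrite ler0n => k0.
by move=> /le_trans; apply; have := ltW Q1; nra.
Qed.

Lemma soft_stepN x : soft_step m L (- x) = 1 - soft_step m L x.
Proof. have q1 := Q1; by rewrite /soft_step mulNr sinN bump_primitiveN; lra. Qed.

End bounds.

(** At the scale L = sqrt(2m+3)/k the slope is at most k and the values beyond e
    are at most 1/(k cos(1) e)^2 = r, whatever m is; a large m makes L as
    large as wanted with the same slope bound. *)
Lemma soft_step_exists (e r : R) : 0 < e -> 0 < r ->
  exists2 K : R, 0 <= K & forall L0 : R, exists m L,
  [/\ 0 < L, L0 <= L, (forall x, `|soft_step' m L x| <= K),
     (forall x, e <= x <= L -> soft_step m L x <= r) &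
     (forall x, - L <= x <= - e -> 1 - r <= soft_step m L x)].
Proof.
move=> e0 r0; have c1 := @cos1_gt0 R.
pose k := (Num.sqrt r * (cos 1 * e))^-1.
have k0 : 0 < k by rewrite invr_gt0 !mulr_gt0// sqrtr_gt0.
exists k; first exact: ltW.
move=> L0.
have [m mL] : exists m : nat, k * `|L0| <= Num.sqrt (2 * m.+1).+1%:R.
  exists (Num.bound ((k * L0) ^+ 2)).
  rewrite -ler_sqr ?nnegrE ?mulr_ge0 ?sqrtr_ge0 ?(ltW k0)//.
  rewrite sqr_sqrtr ?ler0n// exprMn (real_normK (num_real _)) -exprMn.
  have := archi_boundP (sqr_ge0 (k * L0)) => /ltW /le_trans; apply.
  by rewrite ler_nat leqW// (leq_trans (leqnSn _))// leq_pmull.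
exists m, (Num.sqrt (2 * m.+1).+1%:R / k).
have S0 : 0 < Num.sqrt (2 * m.+1).+1%:R :> R by rewrite sqrtr_gt0 ltr0n.
have Lgt0 : 0 < Num.sqrt (2 * m.+1).+1%:R / k by rewrite divr_gt0.
have small x : e <= x <= Num.sqrt (2 * m.+1).+1%:R / k ->
    soft_step m (Num.sqrt (2 * m.+1).+1%:R / k) x <= r.
  move=> /andP[ex xL]; have := soft_step_small m Lgt0 e0 ex xL.
  move=> /le_trans; apply.
  rewrite expr_div_n sqr_sqrtr ?ler0n// /k exprVn invrK exprMn sqr_sqrtr ?(ltW r0)//.
  have : (2 * m.+1).+1%:R != 0 :> R by rewrite pnatr_eq0.
  move: (_.+1%:R) => q q0.
  rewrite le_eqVlt; apply/orP; left; apply/eqP; field.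
  by rewrite q0 !gt_eqF.
split=> //.
- by rewrite ler_pdivlMr// mulrC (le_trans _ mL)// ler_wpM2l ?(ltW k0)// ler_norm.
- move=> x; apply: le_trans (soft_step'_bound m Lgt0 x) _.
  rewrite ler_pdivrMr; last lra.
  have -> : k * (2 * (Num.sqrt (2 * m.+1).+1%:R / k)) =
      2 * Num.sqrt (2 * m.+1).+1%:R.
    by field; rewrite gt_eqF.
  have : Num.sqrt (2 * m).+1%:R <= Num.sqrt (2 * m.+1).+1%:R :> R.
    by rewrite ler_wsqrtr// ler_nat ltnS leq_mul2l leqnSn orbT.
  by lra.
- move=> x xL; rewrite -(opprK x) soft_stepN lerD2l lerN2 small//; lra.
Qed.

End soft_step.

(** * Trigonometric polynomials *)

Section trigonometric_polynomials.
Variables (R : realType) (n : nat).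
Implicit Types (x a : 'I_n -> R) (b c : R) (f : ('I_n -> R) -> R).

Definition phase a b x : R := \sum_i a i * x i + b.

(** A trigonometric polynomial is kept as a list of coefficients, frequency vectors
    and phases, so that a statement about all of them is an induction or a finite
    sum. *)
Definition trig_eval (p : seq (R * ('I_n -> R) * R)) x : R :=
  \sum_(q <- p) q.1.1 * cos (phase q.1.2 q.2 x).

Definition trig_poly f := exists p, forall x, f x = trig_eval p x.

Lemma trig_poly_cst c : trig_poly (fun=> c).
Proof.
exists [:: (c, fun=> 0, 0)] => x.
rewrite /trig_eval big_seq1 /phase/= big1 ?addr0 ?cos0 ?mulr1// => i _.
by rewrite mul0r.
Qed.

Lemma trig_polyD f g : trig_poly f -> trig_poly g ->
  trig_poly (fun x => f x + g x).
Proof.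
move=> [p fp] [q gq]; exists (p ++ q) => x.
by rewrite /trig_eval big_cat/= fp gq.
Qed.

Lemma trig_polyM f g : trig_poly f -> trig_poly g ->
  trig_poly (fun x => f x * g x).
Proof.
move=> [p fp] [q gq].
exists ([seq (u.1.1 * v.1.1 / 2, fun i => u.1.2 i + v.1.2 i, u.2 + v.2)
          | u <- p, v <- q] ++
        [seq (u.1.1 * v.1.1 / 2, fun i => u.1.2 i - v.1.2 i, u.2 - v.2)
          | u <- p, v <- q]) => x.
rewrite /trig_eval big_cat/= !big_allpairs_dep/= fp gq /trig_eval mulr_suml.
rewrite -big_split/=; apply: eq_bigr => u _.
rewrite mulr_sumr -big_split/=; apply: eq_bigr => v _.
have -> : phase (fun i => u.1.2 i + v.1.2 i) (u.2 + v.2) x =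
    phase u.1.2 u.2 x + phase v.1.2 v.2 x.
  rewrite /phase addrACA -big_split/=; congr (_ + _).
  by apply: eq_bigr => i _; rewrite mulrDl.
have -> : phase (fun i => u.1.2 i - v.1.2 i) (u.2 - v.2) x =
    phase u.1.2 u.2 x - phase v.1.2 v.2 x.
  rewrite /phase opprD addrACA -sumrB; congr (_ + _).
  by apply: eq_bigr => i _; rewrite mulrBl.
by rewrite cosD cosB; field.
Qed.

Lemma trig_polyX f m : trig_poly f -> trig_poly (fun x => f x ^+ m).
Proof.
move=> tf; elim: m => [|m IH]; first exact: trig_poly_cst.
have -> : (fun x => f x ^+ m.+1) = fun x => f x * f x ^+ m.
  by apply/funext => x; rewrite exprS.
exact: trig_polyM.
Qed.

Lemma trig_poly_prod (I : Type) (r : seq I) (F : I -> ('I_n -> R) -> R) :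
  (forall i, trig_poly (F i)) -> trig_poly (fun x => \prod_(i <- r) F i x).
Proof.
move=> tF; elim: r => [|i r IH].
  have -> : (fun x => \prod_(i <- [::]) F i x) = fun=> 1.
    by apply/funext => x; rewrite big_nil.
  exact: trig_poly_cst.
have -> : (fun x => \prod_(j <- i :: r) F j x) =
    fun x => F i x * \prod_(j <- r) F j x.
  by apply/funext => x; rewrite big_cons.
exact: trig_polyM.
Qed.

Lemma trig_poly_sin (k : 'I_n) (a b : R) : trig_poly (fun x => sin (a * x k + b)).
Proof.
exists [:: (1, fun i => if i == k then a else 0, b - pi / 2)] => x.
rewrite /trig_eval big_seq1/= mul1r /phase (bigD1 k)//= eqxx big1 ?addr0.
  by rewrite addrA cosBpihalf.
by move=> i /negbTE ->; rewrite mul0r.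
Qed.

Lemma trig_poly_soft_step (k : 'I_n) m L u :
  trig_poly (fun x => soft_step m L (x k - u)).
Proof.
have tsin : trig_poly (fun x => sin ((x k - u) / L)).
  have -> : (fun x => sin ((x k - u) / L)) =
      fun x => sin (L^-1 * x k + - (u / L)).
    by apply/funext => x; rewrite mulrBl mulrC.
  exact: trig_poly_sin.
have tQ : trig_poly (fun x => bump_primitive m (sin ((x k - u) / L))).
  elim: m => [//|m IH] /=; apply: trig_polyM (trig_poly_cst _).
  apply: trig_polyD; last exact: trig_polyM (trig_poly_cst _) IH.
  apply: trig_polyM => //.
  have -> : (fun x => (1 - sin ((x k - u) / L) ^+ 2) ^+ m.+1) =
     fun x => (1 + -1 * sin ((x k - u) / L) ^+ 2) ^+ m.+1.
    by apply/funext => x; rewrite mulN1r.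
  apply: trig_polyX; apply: trig_polyD (trig_poly_cst _) _.
  by apply: trig_polyM (trig_poly_cst _) _; exact: trig_polyX.
rewrite /soft_step; under eq_fun do rewrite -mulNr.
by apply: trig_polyD (trig_poly_cst _) _; exact: trig_polyM (trig_poly_cst _) tQ.
Qed.

(** The formal i-th partial derivative; cos' is the cosine shifted by a quarter turn. *)
Definition trig_partial (i : 'I_n) (p : seq (R * ('I_n -> R) * R)) :=
  [seq (q.1.1 * q.1.2 i, q.1.2, q.2 + pi / 2) | q <- p].

Definition upd x i (s : R) : 'I_n -> R := fun k => if k == i then s else x k.

Lemma upd_id x i : upd x i (x i) = x.
Proof. by apply/funext => k; rewrite /upd; case: eqP => // ->. Qed.

Lemma is_derive_trig_eval p i x (s : R) :
  is_derive s 1 (fun s => trig_eval p (upd x i s))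
    (trig_eval (trig_partial i p) (upd x i s)).
Proof.
rewrite /trig_eval /trig_partial big_map/=; apply: is_derive_bigsum => q.
have E (t : R) : phase q.1.2 q.2 (upd x i t) =
    q.1.2 i * t + (\sum_(k | k != i) q.1.2 k * x k + q.2).
  rewrite /phase (bigD1 i)//= /upd eqxx addrA; congr (_ + _ + _).
  by apply: eq_bigr => k /negbTE ->.
have -> : (fun t : R => q.1.1 * cos (phase q.1.2 q.2 (upd x i t))) =
    fun t => q.1.1 * cos (q.1.2 i * t + (\sum_(k | k != i) q.1.2 k * x k + q.2)).
  by apply/funext => t; rewrite E.
rewrite [phase _ _ _](_ : _ = phase q.1.2 q.2 (upd x i s) + pi / 2).
  by rewrite cosDpihalf E; derive; ring.
by rewrite /phase addrA.
Qed.

(** The list that represents a function is not unique.  This identifies the values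
    of a formal derivative from any other expression of the function, here the
    product of steps. *)
Lemma trig_partial_unique p i x (f : R -> R) df :
  (forall s, trig_eval p (upd x i s) = f s) -> is_derive (x i) 1 f df ->
  trig_eval (trig_partial i p) x = df.
Proof.
move=> pf fdf; have := is_derive_trig_eval p i x (x i).
rewrite upd_id (_ : (fun s => _) = f); last exact/funext.
by move=> [_ <-]; case: fdf => _ <-.
Qed.

Lemma trig_partial2_prod p (h h' : R -> R) :
  (forall s : R, is_derive s 1 h (h' s)) ->
  (forall x, \prod_k h (x k) = trig_eval p x) ->
  forall i j x, i != j -> trig_eval (trig_partial j (trig_partial i p)) x =
    h' (x i) * h' (x j) * \prod_(k | (k != i) && (k != j)) h (x k).
Proof.
move=> dh ph i j x ij.
have d1 y : trig_eval (trig_partial i p) y = h' (y i) * \prod_(k | k != i) h (y k).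
  apply: (@trig_partial_unique _ _ _ (fun s => h s * \prod_(k | k != i) h (y k))).
    move=> s; rewrite -ph (bigD1 i)//= /upd eqxx; congr (_ * _).
    by apply: eq_bigr => k /negbTE ->.
  have dhi := dh (y i).
  by derive; rewrite mulr0 addr0.
apply: (@trig_partial_unique _ _ _ (fun s => h' (x i) * h s *
   \prod_(k | (k != i) && (k != j)) h (x k))).
  move=> s; rewrite d1 (bigD1 j)//= 1?eq_sym// /upd eqxx (negbTE ij) mulrA.
  by congr (_ * _); apply: eq_bigr => k /andP[_ /negbTE ->].
have dhj := dh (x j).
by derive; rewrite mulr0 mul0r add0r addr0.
Qed.

End trigonometric_polynomials.

(** * Gaussian vectors *)

Section real_integrable.
Context d (T : measurableType d) (R : realType) (mu : {measure set T -> \bar R}).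
Implicit Types (f g : T -> R).

Lemma real_integrableD f g :
  mu.-integrable setT (EFin \o f) -> mu.-integrable setT (EFin \o g) ->
  mu.-integrable setT (EFin \o (fun x => f x + g x)).
Proof. by move=> fi gi; have := integrableD measurableT fi gi. Qed.

Lemma real_integrableZl (k : R) f : mu.-integrable setT (EFin \o f) ->
  mu.-integrable setT (EFin \o (fun x => k * f x)).
Proof. by move=> fi; have := integrableZl measurableT k fi. Qed.

Lemma EFin_Rintegral f : mu.-integrable setT (EFin \o f) ->
  (\int[mu]_x (f x)%:E)%E = (\int[mu]_x f x)%:E.
Proof. by move=> fi; rewrite fineK//; exact: integrable_fin_num. Qed.

End real_integrable.

Section bounded_expectations.
Context d (T : measurableType d) (R : realType) (P : probability T R).
Implicit Types (f : T -> R).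

Lemma bounded_integrable f (M : R) : measurable_fun setT f ->
  (forall x, `|f x| <= M) -> P.-integrable setT (EFin \o f).
Proof.
move=> mf fM; apply: measurable_bounded_integrable => //.
  by apply: fin_num_fun_lty; exact: fin_num_measure.
exists M; split; first exact: num_real.
by move=> x Mx y _ /=; rewrite (le_trans (fM y))// ltW.
Qed.

Lemma Rintegral_probability_cst (c : R) : \int[P]_x c = c.
Proof. by rewrite Rintegral_cst//= probability_setT mulr1. Qed.

Lemma Rintegral_probability_indic (A : set T) : measurable A ->
  \int[P]_x \1_A x = fine (P A).
Proof. by move=> mA; rewrite /Rintegral integral_indic// setIT. Qed.

Lemma integrable_affine_indic (A : set T) (c k : R) : measurable A ->
  P.-integrable setT (EFin \o (fun x => c + k * \1_A x)) /\
  \int[P]_x (c + k * \1_A x) = c + k * fine (P A).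
Proof.
move=> mA.
have iA : P.-integrable setT (EFin \o (\1_A : T -> R)) by exact: integrable_indic.
have ikA : P.-integrable setT (EFin \o (fun x => k * \1_A x)).
  exact: real_integrableZl.
have ic : P.-integrable setT (EFin \o (fun _ : T => c)).
  exact: finite_measure_integrable_cst.
split; first exact: real_integrableD.
rewrite RintegralD// RintegralZl// Rintegral_probability_cst.
by rewrite Rintegral_probability_indic.
Qed.

End bounded_expectations.

Definition quad (R : realType) n (C : 'I_n -> 'I_n -> R) (a : 'I_n -> R) : R :=
  \sum_i \sum_j a i * a j * C i j.

(** Stating the law of a centered Gaussian vector through the expectations of
    [cos (a.X + b)] makes it linear in test functions, which is all that the
    comparison below needs. *)
Definition gauss_vec d (T : measurableType d) (R : realType)
    (P : probability T R) n (X : 'I_n -> T -> R) (C : 'I_n -> 'I_n -> R) :=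
  (forall i, measurable_fun setT (X i)) /\
  forall a b, \int[P]_w cos (phase a b (X ^~ w)) =
    expR (- (quad C a / 2)) * cos b.

Section trig_expectations.
Context d (T : measurableType d) (R : realType) (P : probability T R).
Variables (n : nat) (X : 'I_n -> T -> R).
Hypothesis mX : forall i, measurable_fun setT (X i).

Lemma measurable_phase (a : 'I_n -> R) (b : R) :
  measurable_fun setT (fun w => phase a b (X ^~ w)).
Proof.
rewrite /phase; apply: measurable_funD => //.
by apply: measurable_sum => i; exact: measurable_funM.
Qed.

Lemma measurable_trig_eval p : measurable_fun setT (fun w => trig_eval p (X ^~ w)).
Proof.
rewrite /trig_eval; apply: measurable_sum => q.
apply: measurable_funM => //; apply: measurableT_comp => //.
  exact: continuous_measurable_fun (@continuous_cos R).
exact: measurable_phase.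
Qed.

Lemma trig_eval_bounded p : exists M, forall x : 'I_n -> R, `|trig_eval p x| <= M.
Proof.
exists (\sum_(q <- p) `|q.1.1|) => x.
rewrite /trig_eval (le_trans (ler_norm_sum _ _ _))//; apply: ler_sum => q _.
by rewrite normrM ler_piMr// cos_max.
Qed.

Lemma integrable_trig_eval p :
  P.-integrable setT (EFin \o (fun w => trig_eval p (X ^~ w))).
Proof.
have [M pM] := trig_eval_bounded p.
by apply: (@bounded_integrable _ _ _ _ _ M) => //; exact: measurable_trig_eval.
Qed.

Lemma integral_trig_eval (C : 'I_n -> 'I_n -> R) p : gauss_vec P X C ->
  \int[P]_w trig_eval p (X ^~ w) =
  \sum_(q <- p) q.1.1 * (expR (- (quad C q.1.2 / 2)) * cos q.2).
Proof.
move=> [_ gX]; elim: p => [|q p IH].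
  rewrite big_nil; under eq_Rintegral do rewrite /trig_eval big_nil.
  by rewrite Rintegral_probability_cst.
rewrite big_cons -IH -gX.
have E w : trig_eval (q :: p) (X ^~ w) =
    q.1.1 * trig_eval [:: (1, q.1.2, q.2)] (X ^~ w) + trig_eval p (X ^~ w).
  by rewrite /trig_eval big_cons big_seq1/= mul1r.
under eq_Rintegral do rewrite E.
have i1 := integrable_trig_eval [:: (1, q.1.2, q.2)].
rewrite RintegralD//; first last.
- exact: integrable_trig_eval.
- exact: real_integrableZl.
rewrite RintegralZl//; congr (_ * _ + _).
by apply: eq_Rintegral => w _; rewrite /trig_eval big_seq1/= mul1r.
Qed.

End trig_expectations.

Section interpolation.
Context d (T : measurableType d) d' (T' : measurableType d') (R : realType).
Variables (P : probability T R) (P' : probability T' R).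
Variables (n : nat) (X : 'I_n -> T -> R) (Y : 'I_n -> T' -> R).
Variables (CX CY : 'I_n -> 'I_n -> R).
Hypotheses (gX : gauss_vec P X CX) (gY : gauss_vec P' Y CY).

Lemma quadZ (C : 'I_n -> 'I_n -> R) (r : R) a :
  quad C (fun i => r * a i) = r ^+ 2 * quad C a.
Proof.
rewrite /quad mulr_sumr; apply: eq_bigr => i _; rewrite mulr_sumr.
by apply: eq_bigr => j _; ring.
Qed.

Lemma mix_phase (s r : R) a b w w' :
  phase a b (fun i => s * X i w + r * Y i w') =
  phase (fun i => r * a i) (phase (fun i => s * a i) b (X ^~ w)) (Y ^~ w').
Proof.
rewrite /phase addrA; congr (_ + _).
by rewrite -big_split/=; apply: eq_bigr => i _; ring.
Qed.

Lemma mix_inner (s r : R) p w :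
  \int[P']_w' trig_eval p (fun i => s * X i w + r * Y i w') =
  trig_eval [seq (q.1.1 * expR (- (r ^+ 2 * quad CY q.1.2 / 2)),
                  fun i => s * q.1.2 i, q.2) | q <- p] (X ^~ w).
Proof.
have E w' : trig_eval p (fun i => s * X i w + r * Y i w') =
  trig_eval [seq (q.1.1, fun i => r * q.1.2 i,
    phase (fun i => s * q.1.2 i) q.2 (X ^~ w)) | q <- p] (Y ^~ w').
  by rewrite /trig_eval big_map/=; apply: eq_bigr => q _; rewrite mix_phase.
under eq_Rintegral do rewrite E.
have [mY _] := gY.
rewrite (integral_trig_eval mY _ gY) /trig_eval !big_map/=.
by apply: eq_bigr => q _; rewrite quadZ mulrA.
Qed.

(** The iterated integral plays the role of the expectation over independent X and Y.
    Only s^2 and r^2 occur on the right, so with s = sqrt(1-t) and r = sqrt(t) the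
    result is smooth in t up to the endpoints. *)
Lemma mix_integral (s r : R) p :
  \int[P]_w \int[P']_w' trig_eval p (fun i => s * X i w + r * Y i w') =
  \sum_(q <- p) q.1.1 *
    expR (- ((s ^+ 2 * quad CX q.1.2 + r ^+ 2 * quad CY q.1.2) / 2)) * cos q.2.
Proof.
under eq_Rintegral do rewrite mix_inner.
have [mX _] := gX.
rewrite (integral_trig_eval mX _ gX) big_map/=; apply: eq_bigr => q _.
by rewrite quadZ mulrA -(mulrA q.1.1) -expRD; congr (_ * expR _ * _); lra.
Qed.

Lemma mix_integral_ge (s r : R) p (K : R) (A : set T) (A' : set T') :
  measurable A -> measurable A' ->
  (forall w w', - (K * (\1_A w + \1_A' w')) <=
     trig_eval p (fun i => s * X i w + r * Y i w')) ->
  - (K * (fine (P A) + fine (P' A'))) <=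
  \int[P]_w \int[P']_w' trig_eval p (fun i => s * X i w + r * Y i w').
Proof.
move=> mA mA' pK.
have [[mX _] [mY _]] := (gX, gY).
have inner w : - K * fine (P' A') + - K * \1_A w <=
    \int[P']_w' trig_eval p (fun i => s * X i w + r * Y i w').
  have [i1 e1] := integrable_affine_indic P' (- K * \1_A w) (- K) mA'.
  rewrite addrC -e1; apply: le_Rintegral => //.
    apply: integrable_trig_eval => i.
    by apply: measurable_funD => //; exact: measurable_funM.
  by move=> w' _; have := pK w w'; lra.
have [i2 e2] := integrable_affine_indic P (- K * fine (P' A')) (- K) mA.
apply: le_trans (_ : - K * fine (P' A') + - K * fine (P A) <= _); first lra.
rewrite -e2; apply: le_Rintegral => //.
rewrite [X in _.-integrable _ X](_ : _ = EFin \o (fun w =>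
   trig_eval [seq (q.1.1 * expR (- (r ^+ 2 * quad CY q.1.2 / 2)),
                  fun i => s * q.1.2 i, q.2) | q <- p] (X ^~ w))).
  exact: integrable_trig_eval.
by apply/funext => w /=; rewrite mix_inner.
Qed.

End interpolation.

(** * Slepian's inequality *)

Section slepian.
Context d (T : measurableType d) d' (T' : measurableType d') (R : realType).
Variables (P : probability T R) (P' : probability T' R).
Variables (n : nat) (X : 'I_n -> T -> R) (Y : 'I_n -> T' -> R).
Variables (CX CY : 'I_n -> 'I_n -> R).
Hypotheses (gX : gauss_vec P X CX) (gY : gauss_vec P' Y CY).
Hypothesis eq_var : forall i, CX i i = CY i i.
Hypothesis le_cov : forall i j, i != j -> CY i j <= CX i j.

(** Outside the exceptional sets the two factors h' have the same sign; on them the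
    mixed derivative is still at least - K^2. *)
Lemma mixed_partial_ge (h h' : R -> R)
    (p : seq (R * ('I_n -> R) * R)) (K s r : R) (A : set T) (A' : set T') :
  (forall x : R, is_derive x 1 h (h' x)) ->
  (forall x, \prod_k h (x k) = trig_eval p x) ->
  (forall x, 0 <= h x <= 1) -> (forall x, `|h' x| <= K) ->
  (forall w w', ~ A w -> ~ A' w' -> forall k, h' (s * X k w + r * Y k w') <= 0) ->
  forall i j w w', i != j -> - (K ^+ 2 * (\1_A w + \1_A' w')) <=
    trig_eval (trig_partial j (trig_partial i p))
      (fun k => s * X k w + r * Y k w').
Proof.
move=> dh ph h01 hK hneg i j w w' ij.
rewrite (trig_partial2_prod dh ph _ ij).
set u := h' _; set v := h' _; set q := \prod_(_ | _) _.
have /andP[q0 q1] : 0 <= q <= 1.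
  apply/andP; split; first by apply: prodr_ge0 => k _; case/andP: (h01 (s * X k w + r * Y k w')).
  by apply: prodr_ile1 => k _; exact: h01.
have bad : - K ^+ 2 <= u * v * q.
  have : `|u * v * q| <= K ^+ 2.
    rewrite 2!normrM (ger0_norm q0) expr2 -[leRHS]mulr1.
    by rewrite !ler_pM ?mulr_ge0 ?hK.
  by rewrite ler_norml => /andP[].
have K2 : 0 <= K ^+ 2 by exact: sqr_ge0.
rewrite !indicE; have [wA|wA] := boolP (w \in A); have [wA'|wA'] := boolP (w' \in A').
- rewrite mulr1n; nra.
- rewrite mulr1n mulr0n; nra.
- rewrite mulr1n mulr0n; nra.
have nA : ~ A w by move/mem_set; exact/negP.
have nA' : ~ A' w' by move/mem_set; exact/negP.
rewrite !mulr0n addr0 mulr0 oppr0 mulr_ge0//.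
have := hneg w w' nA nA' i; have := hneg w w' nA nA' j.
by rewrite -/u -/v => ? ?; rewrite mulr_le0.
Qed.

(** E f(sqrt(1-t) X + sqrt(t) Y) for the trigonometric polynomial f, in closed form. *)
Let interp (p : seq (R * ('I_n -> R) * R)) (t : R) :=
  \sum_(q <- p) q.1.1 *
    expR (- (((1 - t) * quad CX q.1.2 + t * quad CY q.1.2) / 2)) * cos q.2.

Let interpE p t : 0 <= t <= 1 ->
  interp p t = \int[P]_w \int[P']_w'
    trig_eval p (fun i => Num.sqrt (1 - t) * X i w + Num.sqrt t * Y i w').
Proof.
move=> /andP[t0 t1]; rewrite (mix_integral gX gY) !sqr_sqrtr//; lra.
Qed.

Let D i j := CY i j - CX i j.

Let interp' p t := 2^-1 * \sum_i \sum_j D i j *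
  interp (trig_partial j (trig_partial i p)) t.

(** Differentiating the exponent gives the quadratic form of Cov_Y - Cov_X at the
    frequency vector a, and - a_i a_j is the effect of the two derivatives d_i d_j. *)
Let is_derive_interp p (t : R) : is_derive t 1 (interp p) (interp' p t).
Proof.
pose dF (q : R * ('I_n -> R) * R) := q.1.1 *
   (expR (- (((1 - t) * quad CX q.1.2 + t * quad CY q.1.2) / 2)) *
   - ((quad CY q.1.2 - quad CX q.1.2) / 2)) * cos q.2.
have -> : interp' p t = \sum_(q <- p) dF q.
  rewrite /interp' /interp /trig_partial.
  under eq_bigr => i _.
    under eq_bigr => j _ do rewrite !big_map/= mulr_sumr.
    rewrite exchange_big/=; over.
  rewrite exchange_big/= mulr_sumr; apply: eq_bigr => q _.
  have E : quad CY q.1.2 - quad CX q.1.2 =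
      \sum_i \sum_j q.1.2 i * q.1.2 j * D i j.
    rewrite /quad -sumrB; apply: eq_bigr => i _; rewrite -sumrB.
    by apply: eq_bigr => j _; rewrite /D; ring.
  rewrite /dF E; set e := expR _.
  have -> : cos (q.2 + pi / 2 + pi / 2) = - cos q.2.
    by rewrite -addrA -splitr cosDpi.
  transitivity (- (q.1.1 * e * cos q.2 / 2) *
     \sum_i \sum_j q.1.2 i * q.1.2 j * D i j); last by ring.
  rewrite !mulr_sumr; apply: eq_bigr => i _.
  by rewrite !mulr_sumr; apply: eq_bigr => j _; ring.
apply: (@is_derive_bigsum _ _ _ (fun q t => q.1.1 *
  expR (- (((1 - t) * quad CX q.1.2 + t * quad CY q.1.2) / 2)) * cos q.2)) => q.
by derive; rewrite /dF; ring.
Qed.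

(** Slepian's inequality for products of steps: the derivative of the interpolation
    is at most the error made on the exceptional sets. *)
Lemma slepian_trig (h h' : R -> R)
    (p : seq (R * ('I_n -> R) * R)) (K : R) (A : set T) (A' : set T') :
  (forall x : R, is_derive x 1 h (h' x)) ->
  (forall x, \prod_k h (x k) = trig_eval p x) ->
  (forall x, 0 <= h x <= 1) -> (forall x, `|h' x| <= K) ->
  measurable A -> measurable A' ->
  (forall s r w w', 0 <= s <= 1 -> 0 <= r <= 1 -> ~ A w -> ~ A' w' ->
    forall k, h' (s * X k w + r * Y k w') <= 0) ->
  \int[P']_w \prod_k h (Y k w) <= \int[P]_w \prod_k h (X k w) +
    (\sum_i \sum_j `|CY i j - CX i j|) * K ^+ 2 * (fine (P A) + fine (P' A')).
Proof.
move=> dh ph h01 hK mA mA' hneg.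
set S := \sum_i _; set q := fine _ + _.
have q0 : 0 <= q by rewrite addr_ge0 ?fine_ge0.
have S0 : 0 <= S by rewrite sumr_ge0// => i _; rewrite sumr_ge0.
have -> : \int[P']_w \prod_k h (Y k w) = interp p 1.
  under eq_Rintegral do rewrite ph.
  rewrite (integral_trig_eval (proj1 gY) _ gY); apply: eq_bigr => u _.
  by rewrite subrr mul0r add0r mul1r mulrA.
have -> : \int[P]_w \prod_k h (X k w) = interp p 0.
  under eq_Rintegral do rewrite ph.
  rewrite (integral_trig_eval (proj1 gX) _ gX); apply: eq_bigr => u _.
  by rewrite subr0 mul0r addr0 mul1r mulrA.
have dG (t : R) : is_derive t 1 (fun t => S * K ^+ 2 * q * t - interp p t)
    (S * K ^+ 2 * q - interp' p t).
  by have := is_derive_interp p t => dI; derive; ring.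
suff dG0 (t : R) : 0 <= t <= 1 -> 0 <= S * K ^+ 2 * q - interp' p t.
  have := is_derive_nondecreasing dG dG0 ler01.
  by rewrite mulr0 mulr1; move: (interp p 0) (interp p 1) => z z'; lra.
move=> t01; rewrite subr_ge0 /interp'.
have tsq (r : R) : 0 <= r <= 1 -> 0 <= Num.sqrt r <= 1.
  by move=> /andP[r0 r1]; rewrite sqrtr_ge0/= -[leRHS]sqrtr1 ler_wsqrtr.
have K2 : 0 <= K ^+ 2 by exact: sqr_ge0.
apply: (@le_trans _ _ (2^-1 * \sum_i \sum_j `|D i j| * (K ^+ 2 * q))).
  rewrite ler_pM2l ?invr_gt0//; apply: ler_sum => i _; apply: ler_sum => j _.
  have [<-|ij] := eqVneq i j.
    by rewrite /D eq_var subrr normr0 !mul0r.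
  have D0 : D i j <= 0 by rewrite subr_le0 le_cov.
  rewrite ler0_norm// mulNr -mulrN; apply: ler_wnM2l => //.
  rewrite interpE//; apply: (mix_integral_ge gX gY) => // w w'.
  apply: (mixed_partial_ge dh ph h01 hK) => //.
  by move=> u u' uA uA' k; apply: hneg => //; apply: tsq; move: t01 => /andP[]; lra.
have -> : \sum_i \sum_j `|D i j| * (K ^+ 2 * q) = S * K ^+ 2 * q.
  rewrite /S -mulrA mulr_suml; apply: eq_bigr => i _.
  by rewrite mulr_suml.
have : 0 <= S * K ^+ 2 * q by apply: mulr_ge0 => //; exact: mulr_ge0.
by move: (S * _ * _) => z; lra.
Qed.

End slepian.

Section level_sets.
Context d (T : measurableType d) (R : realType).
Variables (X : T -> R) (mX : measurable_fun setT X).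

Lemma measurable_le_level (u : R) : measurable [set w | X w <= u].
Proof.
have := mX measurableT (measurable_itv `]-oo, u]); rewrite setTI.
by congr measurable; apply/seteqP; split => w /=; rewrite in_itv.
Qed.

Lemma measurable_gt_level (u : R) : measurable [set w | u < X w].
Proof.
have := mX measurableT (measurable_itv `]u, +oo[); rewrite setTI.
by congr measurable; apply/seteqP; split => w /=; rewrite in_itv/= andbT.
Qed.

End level_sets.

Section finite_families.
Context d (T : measurableType d) (R : realType) (P : probability T R).
Variables (n : nat) (X : 'I_n -> T -> R).
Hypothesis mX : forall i, measurable_fun setT (X i).

Lemma measurable_all_le (u : R) : measurable [set w | forall k, X k w <= u].
Proof.
have -> : [set w | forall k, X k w <= u] = \bigcap_(k in setT) [set w | X k w <= u].
  by apply/seteqP; split => w /= h k; [move=> _; exact: h|exact: h k I].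
apply: fin_bigcap_measurable => [|k _]; first exact: finite_finset.
exact: measurable_le_level.
Qed.

End finite_families.

Section slepian_inequality.
Context (R : realType).

Lemma tail_small d (T : measurableType d) (P : probability T R) n
    (X : 'I_n -> T -> R) (mX : forall i, measurable_fun setT (X i)) (e : R) :
  0 < e -> exists N0 : nat, forall N, (N0 <= N)%N ->
  measurable (~` [set w | forall k, `|X k w| <= N%:R]) /\
  fine (P (~` [set w | forall k, `|X k w| <= N%:R])) <= e.
Proof.
move=> e0; pose B N := [set w | forall k, `|X k w| <= N%:R].
have mB N : measurable (B N).
  apply: (@measurable_all_le _ _ _ _ (fun k w => `|X k w|)) => i.
  exact: measurableT_comp.
have BT : \bigcup_N B N = setT.
  apply/seteqP; split => // w _.
  exists (Num.bound (\sum_k `|X k w|)) => // k.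
  rewrite (le_trans _ (ltW (archi_boundP _)))//; last exact: sumr_ge0.
  by rewrite (bigD1 k)//= lerDl sumr_ge0.
have ndB : {homo B : n m / (n <= m)%N >-> (n <= m)%O}.
  move=> N M NM; apply/subsetPset => w /= h k.
  by rewrite (le_trans (h k))// ler_nat.
have := nondecreasing_cvg_mu mB _ ndB.
rewrite BT => /(_ R P measurableT) cvB.
have {cvB} : fine (P (B N)) @[N --> \oo] --> (1 : R).
  by apply: fine_cvg; rewrite -(probability_setT P).
move=> /cvgrPdist_le/(_ _ e0)[N0 _ h]; exists N0 => N N0N.
split; first by apply: measurableC; exact: mB.
have := h N N0N; rewrite /= => {}h.
rewrite probability_setC; last exact: mB.
by rewrite fineB//= ?fin_num_measure//; [rewrite (le_trans (ler_norm _))|exact: mB].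
Qed.

Lemma prod_ge_bernoulli n (F : 'I_n -> R) (r : R) :
  (forall k, 0 <= F k <= 1) -> (forall k, 1 - r <= F k) ->
  1 - n%:R * r <= \prod_k F k.
Proof.
elim: n F => [|n IH] F F01 Fr; first by rewrite big_ord0 mul0r subr0.
rewrite big_ord_recl; have := IH (F \o lift ord0) (fun k => F01 _) (fun k => Fr _).
have := F01 ord0; have := Fr ord0.
have : 0 <= \prod_(i < n) F (lift ord0 i) <= 1.
  by rewrite prodr_ge0 ?prodr_ile1// => i _; have /andP[] := F01 (lift ord0 i).
rewrite -natr1 /=; move: (\prod_(_ < _) _) (F _) => q f.
by move=> /andP[q0 q1] f1 /andP[f0 f01] h; nra.
Qed.

(** The steps pass from 1 to 0 around u + e/2, between the levels u and u + e.
    Their slope bound K depends only on e and on the accuracy, so the exceptional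
    sets, where some coordinate is too large for the step to be monotone, can be
    chosen after K with a negligible contribution. *)
Lemma slepian d (T : measurableType d) d' (T' : measurableType d')
    (P : probability T R) (P' : probability T' R) n
    (X : 'I_n -> T -> R) (Y : 'I_n -> T' -> R) (CX CY : 'I_n -> 'I_n -> R) :
  gauss_vec P X CX -> gauss_vec P' Y CY ->
  (forall i, CX i i = CY i i) -> (forall i j, i != j -> CY i j <= CX i j) ->
  forall u e : R, 0 < e ->
  (P' [set w | forall k, (Y k w <= u)%R] <= P [set w | forall k, (X k w <= u + e)%R])%E.
Proof.
move=> gX gY eq_var le_cov u e e0.
have [[mX _] [mY _]] := (gX, gY).
set EY := [set w | _]; set EX := [set w | _].
have mEX : measurable EX by exact: measurable_all_le.
have mEY : measurable EY by exact: measurable_all_le.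
rewrite -[leLHS]fineK ?fin_num_measure// -[leRHS]fineK ?fin_num_measure//.
rewrite lee_fin; apply/ler_addgt0Pl => eps eps0.
(* Half of eps is for the inaccuracy r of the steps, which counts n times for Y
   and once for X; the other half is for the exceptional sets. *)
pose r : R := eps / 2 / (n.+1)%:R.
have r0 : 0 < r by rewrite !divr_gt0.
have e20 : 0 < e / 2 by rewrite divr_gt0.
have [K K0 step] := soft_step_exists e20 r0.
pose S : R := \sum_i \sum_j `|CY i j - CX i j|.
have S0 : 0 <= S by rewrite sumr_ge0// => i _; rewrite sumr_ge0.
pose eta : R := eps / 2 / (2 * (1 + S * K ^+ 2)).
have SK0 : 0 <= S * K ^+ 2 by rewrite mulr_ge0// sqr_ge0.
have eta0 : 0 < eta by rewrite !divr_gt0//; lra.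
have [N1 tX] := tail_small P mX eta0.
have [N2 tY] := tail_small P' mY eta0.
pose N := maxn N1 N2.
have [mA PA] := tX N (leq_maxl _ _).
have [mA' PA'] := tY N (leq_maxr _ _).
set A := ~` _ in mA PA; set A' := ~` _ in mA' PA'.
pose u' := u + e / 2.
(* sX + rY - u', for 0 <= s, r <= 1, must stay within [-L, L]. *)
have [m [L [L0 NL hK hsmall hbig]]] := step (2 * N%:R + `|u'| + 1).
pose h x := soft_step m L (x - u').
pose h' x := soft_step' m L (x - u').
have h01 x : 0 <= h x <= 1 by exact: soft_step_itv01.
have dh (x : R) : is_derive x 1 h (h' x).
  have dx : is_derive x 1 (fun x => x - u') 1 by derive; lra.
  have := @is_derive1_comp _ (soft_step m L) (fun x => x - u') x _ _
    (is_derive_soft_step m L (x - u')) dx.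
  by rewrite mulr1.
have [p ph] : trig_poly (fun x : 'I_n -> R => \prod_k h (x k)).
  by apply: trig_poly_prod => k; exact: trig_poly_soft_step.
have nAX w : ~ A w -> forall k, `|X k w| <= N%:R by move/contrapT.
have nAY w : ~ A' w -> forall k, `|Y k w| <= N%:R by move/contrapT.
have N0 : 0 <= N%:R :> R by [].
have hX w : ~ A w -> forall k, `|X k w - u'| <= L.
  move=> Aw k; rewrite (le_trans (ler_normB _ _))//.
  by have := nAX _ Aw k; lra.
have hY w : ~ A' w -> forall k, `|Y k w - u'| <= L.
  move=> Aw k; rewrite (le_trans (ler_normB _ _))//.
  by have := nAY _ Aw k; lra.
have := slepian_trig gX gY eq_var le_cov dh ph h01 (fun x => hK (x - u')) mA mA'.
have hneg s t w w' : 0 <= s <= 1 -> 0 <= t <= 1 -> ~ A w -> ~ A' w' ->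
    forall k, h' (s * X k w + t * Y k w') <= 0.
  move=> s01 t01 Aw Aw' k; apply: soft_step'_le0 => //.
  have b (c x : R) : 0 <= c <= 1 -> `|c * x| <= `|x|.
    by move=> /andP[c0 c1]; rewrite normrM ger0_norm// ler_piMl.
  have := b _ (X k w) s01; have := b _ (Y k w') t01.
  have := nAX _ Aw k; have := nAY _ Aw' k.
  have := ler_normB (s * X k w + t * Y k w') u'.
  have := ler_normD (s * X k w) (t * Y k w').
  lra.
move=> /(_ hneg); rewrite -/S => main.
have ub w : \prod_k h (X k w) <= \1_EX w + (r + \1_A w).
  have p1 : \prod_k h (X k w) <= 1 by exact: prodr_ile1.
  rewrite !indicE; have [wE|/negP wE] := boolP (w \in EX).
    by rewrite mulr1n; case: (w \in A); rewrite ?mulr1n ?mulr0n; lra.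
  have [wA|/negP wA] := boolP (w \in A); first by rewrite mulr1n mulr0n; lra.
  have {}wA : ~ A w by move=> /mem_set.
  have /existsNP[k /negP] : ~ EX w by move=> /mem_set.
  rewrite -ltNge => Xk; rewrite !mulr0n add0r addr0.
  rewrite (bigD1 k)//=.
  have q1 : \prod_(i | i != k) h (X i w) <= 1 by exact: prodr_ile1.
  have q0 : 0 <= \prod_(i | i != k) h (X i w).
    by apply: prodr_ge0 => i _; case/andP: (h01 (X i w)).
  have /andP[hk0 hk1] := h01 (X k w).
  have hkr : h (X k w) <= r.
    apply: hsmall; have := hX _ wA k; rewrite ler_norml /u' => /andP[_ ->].
    by rewrite andbT; lra.
  by apply: le_trans hkr; rewrite ler_piMr.
have lb w : \1_EY w + (- (n%:R * r) - \1_A' w) <= \prod_k h (Y k w).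
  have p0 : 0 <= \prod_k h (Y k w).
    by apply: prodr_ge0 => i _; case/andP: (h01 (Y i w)).
  have nr0 : 0 <= n%:R * r by rewrite mulr_ge0// ltW.
  rewrite !indicE; have [wA|/negP wA] := boolP (w \in A').
    by rewrite mulr1n; case: (w \in EY); rewrite ?mulr1n ?mulr0n; lra.
  have {}wA : ~ A' w by move=> /mem_set.
  have [/set_mem wE|/negP wE] := boolP (w \in EY); last by rewrite !mulr0n; lra.
  rewrite mulr1n mulr0n subr0; apply: prod_ge_bernoulli => // k.
  apply: hbig; have := hY _ wA k; have := wE k; rewrite ler_norml /u' => Yk /andP[-> _].
  by rewrite /=; lra.
have mprod d0 (T0 : measurableType d0) (P0 : probability T0 R) (Z : 'I_n -> T0 -> R) :
    (forall k, measurable_fun setT (Z k)) ->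
    P0.-integrable setT (EFin \o (fun w => \prod_k h (Z k w))).
  move=> mZ; rewrite [X in _.-integrable _ X](_ : _ =
    EFin \o (fun w => trig_eval p (Z ^~ w))).
    exact: integrable_trig_eval.
  by apply/funext => w /=; rewrite -ph.
have affine d0 (T0 : measurableType d0) (P0 : probability T0 R) (E F : set T0)
    (c s : R) : measurable E -> measurable F ->
    P0.-integrable setT (EFin \o (fun w => \1_E w + (c + s * \1_F w))) /\
    \int[P0]_w (\1_E w + (c + s * \1_F w)) = fine (P0 E) + (c + s * fine (P0 F)).
  move=> mE mF.
  have iE : P0.-integrable setT (EFin \o (\1_E : T0 -> R)) by exact: integrable_indic.
  have [iF eF] := integrable_affine_indic P0 c s mF.
  split; first exact: real_integrableD.
  by rewrite RintegralD// eF Rintegral_probability_indic.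
have [iX eX] := affine _ _ P EX A r 1 mEX mA.
have [iY eY] := affine _ _ P' EY A' (- (n%:R * r)) (- 1) mEY mA'.
have X1 : \int[P]_w \prod_k h (X k w) <= fine (P EX) + (r + 1 * fine (P A)).
  by rewrite -eX; apply: le_Rintegral => // [|w _]; [exact: mprod|rewrite mul1r].
have Y1 : fine (P' EY) + (- (n%:R * r) + - 1 * fine (P' A')) <=
    \int[P']_w \prod_k h (Y k w).
  by rewrite -eY; apply: le_Rintegral => // [|w _]; [exact: mprod|rewrite mulN1r].
have E1 : n%:R * r + r = eps / 2.
  by rewrite -{2}(mul1r r) -mulrDl natr1 /r mulrC divfK// pnatr_eq0.
have E2 : (1 + S * K ^+ 2) * (eta + eta) = eps / 2.
  by rewrite /eta; field; rewrite gt_eqF//; lra.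
have A0 : 0 <= fine (P A) by rewrite fine_ge0.
have A0' : 0 <= fine (P' A') by rewrite fine_ge0.
move: main X1 Y1 E1 E2 PA PA' SK0 A0 A0'.
move: (S * K ^+ 2) (\int[P]_w _) (\int[P']_w _) (fine (P A)) (fine (P' A')).
move: (n%:R * r) (fine (P EX)) (fine (P' EY)) => nr a b z I I' f f' H1 H2 H3 H4 H5 H6 H7 H8 H9 H10.
nra.
Qed.

End slepian_inequality.

(** * Integrals against the standard normal law *)

Section gaussian_integrals.
Variable R : realType.
Local Notation mu := (@lebesgue_measure R).
Local Notation N01 := (@normal_prob R 0 1).
Local Notation phi := (@normal_pdf R 0 1).

Lemma ge0_integral_normal_prob (m s : R) (f : R -> \bar R) :
  (forall x, (0 <= f x)%E) -> measurable_fun setT f ->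
  (\int[normal_prob m s]_x f x = \int[mu]_x (f x * (normal_pdf m s x)%:E))%E.
Proof.
move=> f0 mf; have dom := @normal_prob_dominates R m s.
rewrite -(Radon_Nikodym_SigmaFinite.change_of_variables dom f0 measurableT mf).
have mpdf : measurable_fun setT (EFin \o normal_pdf m s).
  by apply/measurable_EFinP; exact: measurable_normal_pdf.
have iRN := Radon_Nikodym_SigmaFinite.f_integrable dom.
apply: ae_eq_integral => //.
- by apply: emeasurable_funM => //; exact: measurable_int iRN.
- exact: emeasurable_funM.
apply: ae_eqe_mul2l; apply: integral_ae_eq => // E _ mE.
by rewrite -Radon_Nikodym_SigmaFinite.f_integral.
Qed.

Lemma integral_normal_prob (m s : R) (f : R -> R) :
  (normal_prob m s).-integrable setT (EFin \o f) ->
  mu.-integrable setT (EFin \o (fun x => f x * normal_pdf m s x)) /\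
  \int[normal_prob m s]_x f x = \int[mu]_x (f x * normal_pdf m s x).
Proof.
move=> fint; have [mf _] := integrableP _ _ _ fint.
have mf' : measurable_fun setT f by exact/measurable_EFinP.
have mpdf := @measurable_normal_pdf R m s.
have [ip im] := (integrable_funepos measurableT fint, integrable_funeneg measurableT fint).
have pos (g : R -> \bar R) : (forall x, 0 <= g x)%E ->
    (normal_prob m s).-integrable setT g ->
    mu.-integrable setT (fun x => g x * (normal_pdf m s x)%:E)%E.
  move=> g0 ig; have [mg gy] := integrableP _ _ _ ig.
  apply/integrableP; split.
    by apply: emeasurable_funM => //; exact/measurable_EFinP.
  under eq_integral => x _ do rewrite gee0_abs ?mule_ge0 ?lee_fin ?normal_pdf_ge0//.
  rewrite -ge0_integral_normal_prob//.
  by under eq_integral => x _ do rewrite -(gee0_abs (g0 x)).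
have ip' := pos _ (funepos_ge0 _) ip.
have im' := pos _ (funeneg_ge0 _) im.
have E : EFin \o (fun x => f x * normal_pdf m s x) =
    ((fun x => (EFin \o f)^\+ x * (normal_pdf m s x)%:E) \-
    (fun x => (EFin \o f)^\- x * (normal_pdf m s x)%:E))%E.
  apply/funext => x /=; rewrite -muleBl//; last exact: add_def_funeposneg.
  by have /= <- := congr1 (fun g => g x) (funeposneg (EFin \o f)).
split; first by rewrite E; exact: integrableB.
rewrite /Rintegral; congr fine.
rewrite integralE; transitivity (\int[mu]_x ((EFin \o f)^\+ x * (normal_pdf m s x)%:E)
   - \int[mu]_x ((EFin \o f)^\- x * (normal_pdf m s x)%:E))%E.
  congr (_ - _)%E; apply: ge0_integral_normal_prob => //.
    exact: measurable_funepos.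
  exact: measurable_funeneg.
rewrite -integralB//; apply: eq_integral => x _.
by have := congr1 (fun f => f x) E.
Qed.

Lemma normal_pdf01E (x : R) : phi x = normal_peak 1 * expR (- (x ^+ 2 / 2)).
Proof.
rewrite normal_pdfE// /normal_fun subr0 expr1n.
by congr (_ * expR _); rewrite mulNr.
Qed.

Lemma exprn_fact_expR k (y : R) : 0 <= y -> y ^+ k <= k`!%:R * expR y.
Proof.
move=> y0; case: k => [|k].
  by rewrite expr0 fact0 mul1r; have := expR_ge1Dx y; lra.
have := expR_ge1Dxn k y0 => h.
rewrite mulrC -ler_pdivrMr ?ltr0n ?fact_gt0//; lra.
Qed.

(** x^(2k) exp(-x^2/4) is bounded, so the integrand is dominated by the centered
    normal density of variance 2. *)
Lemma integrable_N01_even_power k :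
  N01.-integrable setT (EFin \o (fun x : R => x ^+ (2 * k))).
Proof.
have mx : measurable_fun setT (fun x : R => x ^+ (2 * k)).
  exact: measurable_funX.
apply/integrableP; split; first exact/measurable_EFinP.
have xge0 (x : R) : 0 <= x ^+ (2 * k) by rewrite exprM exprn_ge0// sqr_ge0.
under eq_integral => x _ do rewrite /= ger0_norm//.
rewrite ge0_integral_normal_prob//; last first.
- exact/measurable_EFinP.
pose s : R := Num.sqrt 2.
have s0 : s != 0 by rewrite gt_eqF// sqrtr_gt0.
pose C : R := normal_peak 1 * (4 ^+ k * k`!%:R) / normal_peak s.
have peak0 : 0 < normal_peak s by exact: normal_peak_gt0.
have peak1 : 0 < normal_peak (1 : R) by exact: normal_peak_gt0.
apply: (@le_lt_trans _ _ (\int[mu]_x (C%:E * (normal_pdf 0 s x)%:E))%E).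
  apply: ge0_le_integral => //.
  - by move=> x _; rewrite mule_ge0 ?lee_fin ?normal_pdf_ge0.
  - apply: emeasurable_funM; apply/measurable_EFinP => //.
    exact: measurable_normal_pdf.
  - by apply: emeasurable_funM => //; apply/measurable_EFinP; exact: measurable_normal_pdf.
  move=> x _; rewrite -EFinM lee_fin normal_pdf01E normal_pdfE//.
  rewrite /normal_fun subr0 sqr_sqrtr// /C.
  have -> : x ^+ (2 * k) = 4 ^+ k * (x ^+ 2 / 4) ^+ k.
    by rewrite exprM -exprMn mulrC divfK.
  have e2 : expR (- (x ^+ 2 / 2)) = expR (- (x ^+ 2 / 4)) * expR (- (x ^+ 2 / 4)).
    by rewrite -expRD; congr expR; field.
  have -> : - x ^+ 2 / (2 *+ 2) = - (x ^+ 2 / 4) by rewrite -mulr_natr -natrM mulNr.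
  have y0 : 0 <= x ^+ 2 / 4 by rewrite divr_ge0// sqr_ge0.
  have := exprn_fact_expR k y0.
  rewrite e2 expRN; move: (x ^+ 2 / 4) y0 => y y0 h.
  have ey := expR_gt0 y.
  rewrite [leRHS](_ : _ = normal_peak 1 * 4 ^+ k * k`!%:R * (expR y)^-1); last first.
    by field; rewrite !gt_eqF.
  rewrite [leLHS](_ : _ = normal_peak 1 * 4 ^+ k * (y ^+ k * (expR y)^-1) *
    (expR y)^-1); last by ring.
  rewrite ler_pM2r ?invr_gt0// ler_pM2l ?mulr_gt0 ?exprn_gt0//.
  by rewrite ler_pdivrMr.
rewrite ge0_integralZl//; last 3 first.
- by apply/measurable_EFinP; exact: measurable_normal_pdf.
- by move=> x _; rewrite lee_fin normal_pdf_ge0.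
- by rewrite lee_fin /C !mulr_ge0 ?invr_ge0 ?exprn_ge0 ?(ltW peak0) ?(ltW peak1).
by rewrite integral_normal_pdf mule1 ltry.
Qed.

Lemma integrable_N01 (f : R -> R) (C : R) k : measurable_fun setT f ->
  (forall x, `|f x| <= C * (1 + x ^+ (2 * k))) ->
  N01.-integrable setT (EFin \o f).
Proof.
move=> mf fC.
have i1 : N01.-integrable setT (EFin \o (fun _ : R => C)).
  exact: finite_measure_integrable_cst.
have i2 : N01.-integrable setT (fun x => C%:E * (EFin \o (fun x : R => (x ^+ (2 * k))%R)) x)%E.
  by apply: integrableZl => //; exact: integrable_N01_even_power.
apply: (le_integrable measurableT _ _ (integrableD measurableT i1 i2)).
  exact/measurable_EFinP.
move=> x _ /=; rewrite lee_fin (le_trans (fC x))// mulrDr mulr1 ler_norm//.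
Qed.

Lemma is_derive_phi (x : R) : is_derive x 1 phi (- x * phi x).
Proof.
have -> : phi = fun y : R => normal_peak 1 * expR (- (y ^+ 2 / 2)).
  by apply/funext => y; rewrite normal_pdf01E.
by derive; rewrite /=; field.
Qed.

(** F vanishes at infinity; let n grow in the fundamental theorem of calculus on
    [-n-1, n+1]. *)
Lemma integral_derivative_eq0 (F F' : R -> R) (K : R) :
  (forall x : R, is_derive x 1 F (F' x)) -> continuous F' ->
  mu.-integrable setT (EFin \o F') -> (forall x, `|F x| * (1 + `|x|) <= K) ->
  \int[mu]_x F' x = 0.
Proof.
move=> dF cF' iF' FK.
pose E (n : nat) : set R := `[- n.+1%:R, n.+1%:R]%classic.
pose f_ n : R -> \bar R := ((EFin \o F') \_ (E n)).
have mE n : measurable (E n) by exact: measurable_itv.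
have mF' : measurable_fun setT (EFin \o F') by case/integrableP: iF'.
have cF x : {for x, continuous F}.
  by apply: differentiable_continuous; apply/derivable1_diffP; have [] := dF x.
have fE n : (\int[mu]_x f_ n x)%E = (F n.+1%:R - F (- n.+1%:R))%:E.
  rewrite -integral_mkcond (@continuous_FTC2 R F' F)//.
  - by rewrite gt0_cp// ltr0n.
  - exact: continuous_subspaceT.
  - split.
    + by move=> x _; have [] := dF x.
    + by apply: cvg_at_right_filter; exact: cF.
    + by apply: cvg_at_left_filter; exact: cF.
  - by move=> x _; rewrite derive1E; have [_ ->] := dF x.
have cv0 : (fun n => (\int[mu]_x f_ n x)%E) @ \oo --> (0%:E : \bar R).
  under eq_fun do rewrite fE.
  apply: cvg_EFin; first exact: nearW.
  apply/cvgrPdist_le => e e0.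
  have K0 : 0 <= K by rewrite (le_trans _ (FK 0))// mulr_ge0.
  exists (Num.bound (2 * K / e)) => // n /= bn.
  rewrite sub0r normrN /comp/=.
  have n0 : 0 < n.+2%:R :> R by rewrite ltr0n.
  have b (x : R) : `|x| = n.+1%:R -> `|F x| <= K / n.+2%:R.
    by move=> xn; rewrite ler_pdivlMr// -natr1 addrC -xn.
  have h1 := b n.+1%:R (ger0_norm (ler0n _ _)).
  have h2 : `|F (- n.+1%:R)| <= K / n.+2%:R by apply: b; rewrite normrN ger0_norm.
  rewrite (le_trans (ler_normB _ _))//.
  have : 2 * K / n.+2%:R <= e.
    rewrite ler_pdivrMr// (mulrC e) -ler_pdivrMr//.
    have /archi_boundP/ltW/le_trans : 0 <= 2 * K / e by rewrite divr_ge0 ?mulr_ge0 ?(ltW e0).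
    apply.
    by rewrite ler_nat (leq_trans bn)// ltnW// ltnW.
  by apply: le_trans; rewrite -mulrA mulr_natl mulr2n lerD.
have cvI : (fun n => (\int[mu]_x f_ n x)%E) @ \oo --> (\int[mu]_x (F' x)%:E)%E.
  have := @dominated_convergence _ _ R mu setT measurableT f_ (EFin \o F')
    (abse \o (EFin \o F')).
  case=> //.
  - by move=> n; apply/(measurable_restrictT _ (mE n)); exact: measurable_funTS.
  - apply: aeW => x _; apply: cvg_near_cst.
    exists (Num.bound `|x|) => // n /= xn.
    rewrite /f_ patchE mem_set// /E/= in_itv/= -ler_norml.
    rewrite (le_trans (ltW (archi_boundP _)))// ler_nat (leq_trans xn)//.
  - exact: integrable_abse.
  - apply: aeW => x n _; rewrite /f_ patchE; case: ifP => //= _.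
    by rewrite normr0 lee_fin.
have /= := cvg_unique _ cvI cv0.
by rewrite /Rintegral => ->.
Qed.

(** Integration by parts against the Gaussian weight.  It yields the mean, the
    variance and the characteristic function. *)
Lemma stein (g g' : R -> R) (M : R) :
  (forall x : R, is_derive x 1 g (g' x)) -> continuous g' ->
  (forall x, `|g x| <= 1 + `|x|) -> (forall x, `|g' x| <= M) ->
  \int[N01]_x (g' x - x * g x) = 0.
Proof.
move=> dg cg' g1 gM.
have cg : continuous g.
  move=> x; apply: differentiable_continuous; apply/derivable1_diffP.
  by have [] := dg x.
have cf : continuous (fun x => g' x - x * g x).
  move=> x; apply: (@continuousB _ _ _ g' (fun x => x * g x)); first exact: cg'.
  by apply: (@continuousM _ _ id g); [exact: cvg_id|exact: cg].
have M0 : 0 <= M by rewrite (le_trans _ (gM 0)).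
have intf : N01.-integrable setT (EFin \o (fun x => g' x - x * g x)).
  apply: (@integrable_N01 _ (M + 2) 1).
    exact: continuous_measurable_fun.
  move=> x; rewrite muln1 (le_trans (ler_normB _ _))// normrM.
  have := g1 x; have := gM x; have := normr_ge0 x; have := normr_ge0 (g x).
  rewrite -(real_normK (num_real x)).
  move: `|x| `|g x| `|g' x| => a b c b0 a0 cM ba.
  have h1 : a * b <= a * (1 + a) by rewrite ler_wpM2l.
  have h2 : 0 <= M * a ^+ 2 by rewrite mulr_ge0// sqr_ge0.
  by have := sqr_ge0 (a - 1); nra.
have [iF ->] := integral_normal_prob intf.
pose c : R := normal_peak 1.
have c0 : 0 < c by exact: normal_peak_gt0.
apply: (@integral_derivative_eq0 (fun x => g x * phi x) _ (4 * c)) => //.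
- move=> x; have hg := dg x; have hp := is_derive_phi x.
  by derive; ring.
- move=> x; apply: (@continuousM _ _ (fun x => g' x - x * g x) phi); first exact: cf.
  exact: continuous_normal_pdf.
move=> x; rewrite normrM normal_pdf01E -/c.
rewrite [`|c * _|]ger0_norm ?mulr_ge0 ?(ltW c0) ?expR_ge0// expRN.
rewrite -(real_normK (num_real x)).
have := expR_ge1Dx (`|x| ^+ 2 / 2); have := expR_gt0 (`|x| ^+ 2 / 2).
have := g1 x; have := normr_ge0 (g x); have := normr_ge0 x.
set e := expR (`|x| ^+ 2 / 2); move: e `|g x| `|x| => e a b b0 a0 ab e0 eb.
have -> : a * (c * e^-1) * (1 + b) = c * (a * (1 + b)) / e by ring.
rewrite ler_pdivrMr// [4 * c]mulrC -mulrA ler_pM2l//.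
have h : a * (1 + b) <= (1 + b) * (1 + b) by rewrite ler_wpM2r//; lra.
by have := sqr_ge0 (1 - b); nra.
Qed.

(** By Stein's identity for sin(t x + b), the function psi below satisfies
    psi'(t) = - t psi(t), so psi(t) exp(t^2/2) is constant. *)
Lemma integral_N01_cos (u b : R) :
  \int[N01]_x cos (u * x + b) = expR (- (u ^+ 2 / 2)) * cos b.
Proof.
pose psi (t : R) : R := \int[N01]_x cos (t * x + b).
have caff (t : R) : continuous (fun x : R => t * x + b).
  move=> x; apply: (@continuousD _ _ _ (fun x => t * x) (fun=> b)).
    by apply: (@continuousM _ _ (fun=> t) id); [exact: cst_continuous|exact: cvg_id].
  exact: cst_continuous.
have ccos (t : R) : continuous (fun x : R => cos (t * x + b)).
  by move=> x; apply: continuous_comp; [exact: caff|exact: continuous_cos].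
have csin (t : R) : continuous (fun x : R => sin (t * x + b)).
  by move=> x; apply: continuous_comp; [exact: caff|exact: continuous_sin].
have icos (t : R) : N01.-integrable setT (EFin \o (fun x => cos (t * x + b))).
  apply: (@bounded_integrable _ _ _ _ _ 1).
    exact: continuous_measurable_fun.
  by move=> x; exact: cos_max.
have ixsin (t : R) : N01.-integrable setT (EFin \o (fun x => x * sin (t * x + b))).
  apply: (@integrable_N01 _ 1 1).
    by apply: continuous_measurable_fun => x; apply: continuousM => //; exact: csin.
  move=> x; rewrite muln1 mul1r normrM -(real_normK (num_real x)).
  have := sin_max (t * x + b); have := normr_ge0 x.
  by move: `|x| `|sin _| (normr_ge0 (sin (t * x + b))) => v w w0 v0 w1; nra.
have st (t : R) : \int[N01]_x (x * sin (t * x + b)) = t * psi t.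
  have := @stein (fun x => sin (t * x + b)) (fun x => t * cos (t * x + b)) `|t|.
  rewrite RintegralB//; last first.
    exact: real_integrableZl.
  rewrite RintegralZl// -/(psi t) => h; apply/esym/eqP; rewrite -subr_eq0; apply/eqP.
  apply: h.
  - by move=> x; derive; rewrite mul0r add0r mulr1 addr0 mulrC.
  - by move=> x; apply: (@continuousM _ _ (fun=> t)); [exact: cst_continuous|exact: ccos].
  - by move=> x; rewrite (le_trans (sin_max _))// lerDl.
  - by move=> x; rewrite normrM ler_piMr// cos_max.
have dpsi (t : R) : is_derive t 1 psi (- (t * psi t)).
  pose f (t x : R) : R := cos (t * x + b).
  have df (s x : R) : is_derive s 1 (f ^~ x) (- (x * sin (s * x + b))).
    by rewrite /f; derive; ring.
  have d1f s x : partial1of2 f s x = - (x * sin (s * x + b)).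
    by rewrite partial1of2E; have [_ ->] := df s x.
  have ta : `]t - 1, t + 1[%classic t by rewrite /= in_itv/=; apply/andP; split; lra.
  have iG : N01.-integrable setT (EFin \o (fun x : R => `|x|)).
    apply: (@integrable_N01 _ 1 1); first exact: measurableT_comp.
    move=> x; rewrite muln1 mul1r normr_id -(real_normK (num_real x)).
    by have := normr_ge0 x; nra.
  have drv := @derivable_under_integral R _ _ N01 f setT measurableT t _ _ ta
     (fun s _ => icos s) (fun s x _ _ => @ex_derive _ _ _ _ _ _ _ (df s x))
     (fun x => `|x|) (fun x => normr_ge0 x) iG.
  have der := @differentiation_under_integral R _ _ N01 f setT measurableT t _ _ ta
     (fun s _ => icos s) (fun s x _ _ => @ex_derive _ _ _ _ _ _ _ (df s x))
     (fun x => `|x|) (fun x => normr_ge0 x) iG.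
  have bd s x : `]t - 1, t + 1[%classic s -> setT x -> `|partial1of2 f s x| <= `|x|.
    by move=> _ _; rewrite d1f normrN normrM ler_piMr// sin_max.
  apply: DeriveDef; first exact: drv.
  rewrite -derive1E der//; under eq_Rintegral do rewrite d1f -mulN1r.
  by rewrite RintegralZl// st mulN1r.
have dcst (s : R) : is_derive s 1 (fun t => psi t * expR (t ^+ 2 / 2)) 0.
  by have := dpsi s => h; derive; rewrite /=; field.
have := is_derive_0_is_cst u 0 dcst.
rewrite /psi expr0n/= mul0r expR0 mulr1 => h.
have e0 : expR (u ^+ 2 / 2) != 0 by rewrite gt_eqF// expR_gt0.
apply: (mulIf e0); rewrite h mulrAC -expRD addNr expR0 mul1r.
under eq_Rintegral do rewrite mul0r add0r.
by rewrite Rintegral_probability_cst.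
Qed.

Lemma integral_N01_id : \int[N01]_x x = 0.
Proof.
have := @stein (fun=> (-1 : R)) (fun=> (0 : R)) 0.
under eq_Rintegral do rewrite sub0r mulrN1 opprK.
apply.
- by move=> x; exact: cst_continuous.
- by move=> x; rewrite normrN1 lerDl.
- by move=> x; rewrite normr0.
Qed.

Lemma integral_N01_sqr : \int[N01]_x (x ^+ 2) = 1.
Proof.
have := @stein id (fun=> (1 : R)) 1.
have i2 := integrable_N01_even_power 1.
have i1 : N01.-integrable setT (EFin \o (fun _ : R => 1 : R)).
  exact: finite_measure_integrable_cst.
rewrite muln1 in i2; under eq_Rintegral do rewrite -expr2.
rewrite RintegralB// Rintegral_probability_cst => h.
apply/eqP; rewrite eq_sym -subr_eq0; apply/eqP; apply: h.
- by move=> x; exact: cst_continuous.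
- by move=> x; rewrite lerDr.
- by move=> x; rewrite normr1.
Qed.

End gaussian_integrals.

(** * Centered Gaussian variables *)

Section gaussian_transfer.
Context d (T : measurableType d) (R : realType) (P : probability T R).
Local Notation N01 := (@normal_prob R 0 1).

Lemma normal_prob_affine (m s : R) (f : R -> R) : 0 < s ->
  continuous f -> (forall x, 0 <= f x) ->
  (\int[normal_prob m s]_x (f x)%:E = \int[N01]_x (f (m + s * x))%:E)%E.
Proof.
move=> s0 cf f0; have sn0 : s != 0 by rewrite gt_eqF.
have caff : continuous (fun x : R => m + s * x).
  move=> x; apply: (@continuousD _ _ _ (fun=> m) (fun x => s * x)).
    exact: cst_continuous.
  by apply: (@continuousM _ _ (fun=> s) id); [exact: cst_continuous|exact: cvg_id].
have cfaff : continuous (fun x : R => f (m + s * x)).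
  by move=> x; apply: continuous_comp; [exact: caff|exact: cf].
have mf : measurable_fun setT f by exact: continuous_measurable_fun.
have mff : measurable_fun setT (fun x => (f (m + s * x))%:E).
  by apply/measurable_EFinP; exact: continuous_measurable_fun.
have mf' : measurable_fun setT (fun x => (f x)%:E) by exact/measurable_EFinP.
have fE x : (0 <= (f x)%:E)%E by rewrite lee_fin.
apply: (etrans (@ge0_integral_normal_prob R m s _ fE mf')).
apply: etrans (esym (@ge0_integral_normal_prob R 0 1 _ (fun x => fE (m + s * x)) mff)).
pose F (x : R) : R := m + s * x.
have dF (x : R) : is_derive x 1 F s by rewrite /F; derive; ring.
have F'E : F^`()%classic = fun=> s.
  by apply/funext => x; rewrite derive1E; have [_ ->] := dF x.
have Fmono : {homo F : x y / x < y} by move=> x y xy; rewrite ltrD2l ltr_pM2l.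
have Fy : F x @[x --> +oo] --> +oo.
  apply/cvgryPge => A; exists (s^-1 * (A - m)); split; first exact: num_real.
  by move=> x /ltW; rewrite ler_pdivrMl// lerBlDl.
have FNy : F x @[x --> -oo] --> -oo.
  apply/cvgrNyPle => A; exists (s^-1 * (A - m)); split; first exact: num_real.
  by move=> x /ltW; rewrite ler_pdivlMl// lerBrDl.
have dens x : f (F x) * normal_pdf m s (F x) * s = f (F x) * normal_pdf 0 1 x.
  rewrite -mulrA; congr (_ * _).
  rewrite !normal_pdfE ?oner_eq0// /normal_fun subr0 /F (addrC m) addrK.
  rewrite expr1n mulrAC exprMn -mulr_natr -[in RHS]mulr_natr.
  have -> : - (s ^+ 2 * x ^+ 2) / (s ^+ 2 * 2) = - x ^+ 2 / (1 * 2).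
    by field; rewrite sn0.
  congr (_ * _); rewrite /normal_peak expr1n mul1r -mulrnAr sqrtrM ?sqr_ge0//.
  by rewrite sqrtr_sqr gtr0_norm// invfM mulrAC mulVf// mul1r.
under eq_integral do rewrite -EFinM.
have h1 : continuous F^`()%classic by rewrite F'E => x; exact: cst_continuous.
have h2 : cvg (F^`()%classic x @[x --> -oo]) by rewrite F'E; exact: is_cvg_cst.
have h3 : cvg (F^`()%classic x @[x --> +oo]) by rewrite F'E; exact: is_cvg_cst.
have h4 x : derivable F x 1 by have [] := dF x.
have h5 : continuous (fun x => f x * normal_pdf m s x).
  by move=> x; apply: continuousM; [exact: cf|exact: continuous_normal_pdf].
have h6 x : 0 <= f x * normal_pdf m s x by rewrite mulr_ge0// normal_pdf_ge0.
apply: (etrans (increasing_ge0_integration_by_substitutionT Fmono h1 h2 h3 h4 FNy Fy h5 h6)).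
by apply: eq_integral => x _; rewrite F'E -EFinM -dens.
Qed.

(** Both the degenerate law (s = 0) and the density case are expressed through
    the standard normal law, which removes the case distinction from here on. *)
Lemma gaussian_transfer (X : T -> R) : measurable_fun setT X -> gaussian_rv P X ->
  exists m s : R, 0 <= s /\ forall f : R -> R, continuous f ->
    (forall x, 0 <= f x) ->
    (\int[P]_w (f (X w))%:E = \int[N01]_x (f (m + s * x))%:E)%E.
Proof.
move=> mX [m [s [s0 law]]]; exists m, s; split => // f cf f0.
have mX' : measurable_fun setT (X : T -> measurableTypeR R) by exact: mX.
pose Xm : {mfun T >-> measurableTypeR R} :=
  HB.pack (X : T -> measurableTypeR R) (isMeasurableFun.Build _ _ _ _ _ mX').
have mf : measurable_fun [set: measurableTypeR R] (EFin \o f).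
  by apply/measurable_EFinP; exact: continuous_measurable_fun.
have pushE : (\int[P]_w (f (X w))%:E = \int[distribution P Xm]_y (f y)%:E)%E.
  rewrite (@ge0_integral_pushforward _ _ _ _ _ Xm mX' P setT (EFin \o f))//.
  by move=> y _; rewrite lee_fin.
have [s00|sn0] := eqVneq s 0.
  rewrite pushE (@eq_measure_integral _ _ _ _ \d_(m : measurableTypeR R)); last first.
    by move=> A mA _; have := law A mA; rewrite s00 eqxx.
  rewrite integral_dirac// diracT mul1e.
  rewrite s00 [RHS](eq_integral (fun=> (f m)%:E)); last first.
    by move=> x _; rewrite mul0r addr0.
  by rewrite integral_cst//= probability_setT mule1.
have spos : 0 < s by rewrite lt_neqAle eq_sym sn0.
apply: etrans (normal_prob_affine m spos cf f0).
rewrite pushE; apply: eq_measure_integral => A mA _.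
by have := law A mA; rewrite (negbTE sn0).
Qed.

Lemma integral_N01_affine_sqr (m s : R) :
  (\int[N01]_x ((m + s * x) ^+ 2)%:E = (m ^+ 2 + s ^+ 2)%:E)%E.
Proof.
have i0 : N01.-integrable setT (EFin \o (fun _ : R => m ^+ 2)).
  exact: finite_measure_integrable_cst.
have ix : N01.-integrable setT (EFin \o (fun x : R => x)).
  apply: (@integrable_N01 _ _ 1 1) => // x; rewrite muln1 mul1r.
  by rewrite -(real_normK (num_real x)); have := normr_ge0 x; nra.
have ix2 := @integrable_N01_even_power R 1; rewrite muln1 in ix2.
have i1 : N01.-integrable setT (EFin \o (fun x : R => 2 * m * s * x)).
  exact: real_integrableZl.
have i2 : N01.-integrable setT (EFin \o (fun x : R => s ^+ 2 * x ^+ 2)).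
  exact: real_integrableZl.
have i12 := real_integrableD i1 i2.
have E x : (m + s * x) ^+ 2 = m ^+ 2 + (2 * m * s * x + s ^+ 2 * x ^+ 2) by ring.
under eq_integral do rewrite E.
rewrite (EFin_Rintegral (real_integrableD i0 i12)) !RintegralD//.
rewrite Rintegral_probability_cst !RintegralZl// integral_N01_id integral_N01_sqr.
by rewrite mulr0 add0r mulr1.
Qed.

(** That the mean parameter m vanishes is read off from
    E X^2 - E (X-1)^2 = m^2 - (m-1)^2. *)
Lemma centered_gaussian (X : T -> R) : measurable_fun setT X ->
  gaussian_rv P X -> ('E_P[X] = 0)%E -> exists s : R,
  [/\ 0 <= s, P.-integrable setT (EFin \o (fun w => X w ^+ 2)),
     \int[P]_w X w ^+ 2 = s ^+ 2 &
     forall f : R -> R, continuous f -> (forall x, 0 <= f x) ->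
     (\int[P]_w (f (X w))%:E = \int[N01]_x (f (s * x))%:E)%E].
Proof.
move=> mX gX; have [m [s [s0 tr]]] := gaussian_transfer mX gX.
rewrite unlock => X0; exists s.
have tr2 c : (\int[P]_w ((X w - c) ^+ 2)%:E = ((m - c) ^+ 2 + s ^+ 2)%:E)%E.
  rewrite (tr (fun x => (x - c) ^+ 2)); first last.
  - by move=> x; exact: sqr_ge0.
  - move=> x; apply: (@continuous_comp _ _ _ (fun x => x - c) (fun x => x ^+ 2)).
      by apply: (@continuousB _ _ _ id (fun=> c)); [exact: cvg_id|exact: cst_continuous].
    exact: exprn_continuous.
  rewrite -integral_N01_affine_sqr; apply: eq_integral => x _.
  by congr (EFin (_ ^+ 2)); ring.
have tr20 : (\int[P]_w (X w ^+ 2)%:E = (m ^+ 2 + s ^+ 2)%:E)%E.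
  by rewrite -{1}(subr0 m) -tr2; apply: eq_integral => w _; rewrite subr0.
have iX2 : P.-integrable setT (EFin \o (fun w => X w ^+ 2)).
  apply/integrableP; split.
    by apply/measurable_EFinP; exact: measurable_funX.
  under eq_integral do rewrite /= ger0_norm ?sqr_ge0//.
  by rewrite tr20 ltry.
have iX : P.-integrable setT (EFin \o X).
  have i1 : P.-integrable setT (EFin \o (fun _ : T => 1 : R)).
    exact: finite_measure_integrable_cst.
  apply: (le_integrable measurableT _ _ (real_integrableD i1 iX2)).
    exact/measurable_EFinP.
  move=> w _ /=; rewrite lee_fin [leRHS]ger0_norm ?addr_ge0 ?sqr_ge0//.
  by rewrite -(real_normK (num_real (X w))); have := normr_ge0 (X w); nra.
have EX0 : \int[P]_w X w = 0 by rewrite /Rintegral X0.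
have EX2 : \int[P]_w X w ^+ 2 = m ^+ 2 + s ^+ 2.
  by rewrite /Rintegral tr20.
have m0 : m = 0.
  have := tr2 1.
  have E w : (X w - 1) ^+ 2 = X w ^+ 2 + (-2 * X w + 1) by ring.
  have i1 : P.-integrable setT (EFin \o (fun _ : T => 1 : R)).
    exact: finite_measure_integrable_cst.
  have i2 : P.-integrable setT (EFin \o (fun w => -2 * X w)) by exact: real_integrableZl.
  have i3 := real_integrableD i2 i1.
  under eq_integral do rewrite E.
  rewrite (EFin_Rintegral (real_integrableD iX2 i3)) !RintegralD// RintegralZl//.
  rewrite Rintegral_probability_cst EX0 EX2 => -[]; lra.
split=> //; first by rewrite EX2 m0 expr0n add0r.
by move=> f cf f0; rewrite tr// m0; under eq_integral do rewrite add0r.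
Qed.

(** The transfer formula concerns nonnegative functions, hence is applied to
    1 + cos. *)
Lemma centered_gaussian_cos (X : T -> R) (s b : R) : measurable_fun setT X ->
  (forall f : R -> R, continuous f -> (forall x, 0 <= f x) ->
     (\int[P]_w (f (X w))%:E = \int[N01]_x (f (s * x))%:E)%E) ->
  \int[P]_w cos (X w + b) = expR (- (s ^+ 2 / 2)) * cos b.
Proof.
move=> mX tr; rewrite -integral_N01_cos.
have mcos : measurable_fun setT (@cos R).
  exact: continuous_measurable_fun (@continuous_cos R).
have key d0 (T0 : measurableType d0) (P0 : probability T0 R) (Y : T0 -> R) :
    measurable_fun setT Y -> (\int[P0]_w (1 + cos (Y w + b))%:E)%E =
      (1 + \int[P0]_w cos (Y w + b))%:E.
  move=> mY.
  have ic : P0.-integrable setT (EFin \o (fun w => cos (Y w + b))).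
    apply: (@bounded_integrable _ _ _ _ _ 1) => [|w]; last exact: cos_max.
    by apply: measurableT_comp => //; exact: measurable_funD.
  have i1 : P0.-integrable setT (EFin \o (fun _ : T0 => 1 : R)).
    exact: finite_measure_integrable_cst.
  by rewrite (EFin_Rintegral (real_integrableD i1 ic)) RintegralD//
    Rintegral_probability_cst.
have := tr (fun x => 1 + cos (x + b)).
rewrite key// (key _ _ N01 (fun x => s * x)); last exact: measurable_funM.
have cf : continuous (fun x : R => 1 + cos (x + b)).
  move=> x; apply: (@continuousD _ _ _ (fun=> (1 : R)) (fun x => cos (x + b))).
    exact: cst_continuous.
  apply: (@continuous_comp _ _ _ (fun x => x + b) cos); last exact: continuous_cos.
  by apply: (@continuousD _ _ _ id (fun=> b)); [exact: cvg_id|exact: cst_continuous].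
have f0 x : 0 <= 1 + cos (x + b) by have := cos_geN1 (x + b); lra.
by move=> /(_ cf f0) [/addrI].
Qed.

End gaussian_transfer.

(** * Absolute moments of the standard normal law *)

Section absolute_moments.
Variable R : realType.
Local Notation mu := (@lebesgue_measure R).
Local Notation N01 := (@normal_prob R 0 1).
Local Notation phi := (@normal_pdf R 0 1).

Lemma continuous_powR_gt0 (a x : R) : 0 < x -> {for x, continuous (fun y : R => y `^ a)}.
Proof.
move=> x0; apply: differentiable_continuous; apply/derivable1_diffP.
by have [] := is_derive1_powR a x0.
Qed.

Lemma continuous_norm_powR (a : R) : 0 < a -> continuous (fun x : R => `|x| `^ a).
Proof.
move=> a0 x; have [->|x0] := eqVneq x 0; last first.
  apply: (@continuous_comp R R R (fun x : R => `|x|) (fun y : R => y `^ a)).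
    exact: norm_continuous.
  by apply: continuous_powR_gt0; rewrite normr_gt0.
apply/cvgrPdist_le => e e0; rewrite normr0 powR0 ?gt_eqF//.
have e1 : 0 < e `^ a^-1 by rewrite powR_gt0.
exists (e `^ a^-1) => //= y; rewrite /= sub0r normrN => /ltW ye.
rewrite sub0r normrN ger0_norm ?powR_ge0//.
have -> : e = (e `^ a^-1) `^ a by rewrite -powRrM mulVf ?gt_eqF// powRr1// ltW.
by apply: ge0_ler_powR; rewrite ?nnegrE ?(ltW a0) ?(ltW e1).
Qed.

Lemma integrable_N01_norm_powR (a : R) : 0 < a ->
  N01.-integrable setT (EFin \o (fun x : R => `|x| `^ a)).
Proof.
move=> a0; pose k := Num.bound a.
apply: (@integrable_N01 _ _ 1 k).
  by apply: continuous_measurable_fun; exact: continuous_norm_powR.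
move=> x; rewrite mul1r ger0_norm ?powR_ge0//.
have xk0 : 0 <= x ^+ (2 * k) by rewrite exprM exprn_ge0// sqr_ge0.
have [x1|x1] := leP `|x| 1.
  rewrite (le_trans _ (_ : 1 <= _))//; last by lra.
  rewrite [leRHS](_ : 1 = 1 `^ a); last by rewrite powR1.
  apply: ge0_ler_powR; rewrite ?nnegrE//.
  exact: ltW.
rewrite (le_trans _ (_ : x ^+ (2 * k) <= _))//; last by lra.
have -> : x ^+ (2 * k) = `|x| `^ (2 * k)%:R.
  by rewrite powR_mulrn// !exprM real_normK// num_real.
apply: ler_powR; first exact: ltW.
rewrite (le_trans (ltW (archi_boundP (ltW a0))))// ler_nat.
by rewrite leq_pmull.
Qed.

Section gamma_substitution.
Variables (g a : R).
Hypotheses (g_gt0 : 0 < g) (a_gt0 : 0 < a).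

(** The inverse y = sqrt(2t) of t = y^2/2. *)
Definition half_square_inv (t : R) : R := 2 `^ 2^-1 * t `^ 2^-1.
Local Notation F := half_square_inv.

Let F' (t : R) : R := 2 `^ 2^-1 * (2^-1 * t `^ (2^-1 - 1)).

Let is_derive_F (t : R) : 0 < t -> is_derive t 1 F (F' t).
Proof.
move=> t0; have h := is_derive1_powR 2^-1 t0.
by rewrite /F; derive; rewrite mul0r add0r.
Qed.

Let derive_F (t : R) : 0 < t -> F^`()%classic t = F' t.
Proof. by move=> t0; rewrite derive1E; have [_ ->] := is_derive_F t0. Qed.

Let continuous_F' (t : R) : 0 < t -> {for t, continuous F'}.
Proof.
move=> t0; apply: (@continuousM _ _ (fun=> (2 : R) `^ 2^-1)
  (fun t => 2^-1 * t `^ (2^-1 - 1))); first exact: cst_continuous.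
apply: (@continuousM _ _ (fun=> (2 : R)^-1) (fun t : R => t `^ (2^-1 - 1))).
  exact: cst_continuous.
exact: continuous_powR_gt0.
Qed.

Lemma half_square_invK (y : R) : 0 <= y -> F (y ^+ 2 / 2) = y.
Proof.
move=> y0; rewrite /F -powRM ?divr_ge0 ?sqr_ge0//.
by rewrite mulrC divfK// powR12_sqrt ?sqr_ge0// sqrtr_sqr ger0_norm.
Qed.

Lemma half_square_inv_lt (x y : R) : 0 <= x -> x < y -> F x < F y.
Proof.
move=> x0 xy; rewrite /F ltr_pM2l ?powR_gt0//.
by apply: gt0_ltr_powR; rewrite ?nnegrE ?(le_trans x0 (ltW xy)).
Qed.

Lemma half_square_inv_le (x y : R) : 0 <= x -> x <= y -> F x <= F y.
Proof.
move=> x0 xy; rewrite /F ler_pM2l ?powR_gt0//.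
by apply: ge0_ler_powR; rewrite ?nnegrE ?(le_trans x0 xy).
Qed.

Let F_sqr (t : R) : 0 <= t -> F t ^+ 2 = 2 * t.
Proof. by move=> t0; rewrite /F exprMn !powR12_sqrt// !sqr_sqrtr. Qed.

Let F_ge0 (t : R) : 0 <= F t. Proof. by rewrite mulr_ge0// powR_ge0. Qed.

Let cvgF'y : F^`()%classic t @[t --> +oo] --> (0 : R).
Proof.
apply/cvgrPdist_le => e e0; exists ((2 `^ 2^-1 * 2^-1 / e) ^+ 2); split.
  exact: num_real.
move=> t tM; have t0 : 0 < t by rewrite (le_lt_trans _ tM)// sqr_ge0.
rewrite sub0r normrN derive_F// /F' -[2^-1 - 1](_ : - 2^-1 = _); last by field.
have K0 : 0 <= 2 `^ 2^-1 * 2^-1 :> R by rewrite mulr_ge0// powR_ge0.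
rewrite powRN mulrA ger0_norm; last by rewrite mulr_ge0// invr_ge0 powR_ge0.
rewrite ler_pdivrMr ?powR_gt0// -ler_pdivrMl// [e^-1 * _]mulrC [t `^ _]powR12_sqrt ?(ltW t0)//.
have e0' : 0 <= 2 `^ 2^-1 * 2^-1 / e by rewrite divr_ge0// ltW.
rewrite -(ger0_norm e0') -sqrtr_sqr ler_wsqrtr// ltW//.
Qed.

Let cvgFy : F t @[t --> +oo] --> +oo.
Proof.
apply/cvgryPge => A; exists (A ^+ 2); split; first exact: num_real.
move=> t At; have t0 : 0 <= t by rewrite ltW// (le_lt_trans _ At)// sqr_ge0.
rewrite (le_trans (ler_norm A))// -sqrtr_sqr /F !powR12_sqrt//.
rewrite (le_trans (ler_wsqrtr (ltW At)))// ler_peMl ?sqrtr_ge0//.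
by rewrite -[leLHS]sqrtr1 ler_wsqrtr// ler1n.
Qed.

(** The half-line is cut at a > 0 because the derivative of sqrt(2t) is unbounded
    near 0. *)
Lemma gamma_substitution :
  (\int[mu]_(y in `[F a, +oo[) (`|y| `^ g * phi y)%:E =
   \int[mu]_(t in `[a, +oo[) ((normal_peak 1 * 2 `^ ((g - 1) / 2)) *
      (t `^ ((g + 1) / 2 - 1) * expR (- t)))%:E)%E.
Proof.
have near_gt0 (t : R) : 0 < t -> \forall u \near t, F' u = F^`()%classic u.
  move=> t0; near=> u; rewrite derive_F//.
  by near: u; exact: lt_nbhsr.
have h1 : {in `[a, +oo[ &, {homo F : x y / x < y}}.
  move=> x y; rewrite !in_itv/= !andbT => ax ay xy.
  by apply: half_square_inv_lt => //; rewrite (le_trans (ltW a_gt0)).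
have h2 : {in `]a, +oo[, continuous F^`()%classic}.
  move=> t; rewrite in_itv/= andbT => at0.
  have t0 := lt_trans a_gt0 at0.
  rewrite /continuous_at derive_F//.
  exact: cvg_trans (near_eq_cvg (near_gt0 _ t0)) (continuous_F' t0).
have h3 : cvg (F^`()%classic x @[x --> a^'+]).
  apply/cvg_ex; exists (F' a).
  apply: cvg_at_right_filter.
  exact: cvg_trans (near_eq_cvg (near_gt0 _ a_gt0)) (continuous_F' a_gt0).
have h4 : cvg (F^`()%classic x @[x --> +oo]) by apply/cvg_ex; exists 0.
have cF (t : R) : 0 < t -> {for t, continuous F}.
  move=> t0; apply: differentiable_continuous; apply/derivable1_diffP.
  by have [] := is_derive_F t0.
have h5 : derivable_oy_Rcontinuous F a.
  split; last by apply: cvg_at_right_filter; exact: cF.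
  move=> t; rewrite in_itv/= andbT => at0.
  by have [] := is_derive_F (lt_trans a_gt0 at0).
have cG : continuous (fun y : R => `|y| `^ g * phi y).
  move=> y; apply: (@continuousM R R (fun y : R => `|y| `^ g) phi).
    exact: continuous_norm_powR.
  exact: continuous_normal_pdf.
have h6 : {within `[F a, +oo[, continuous (fun y : R => `|y| `^ g * phi y)}.
  exact: continuous_subspaceT.
have h7 : {in `]F a, +oo[, forall y : R, 0 <= `|y| `^ g * phi y}.
  by move=> y _; rewrite mulr_ge0 ?powR_ge0 ?normal_pdf_ge0.
apply: (etrans (increasing_ge0_integration_by_substitutiony h1 h2 h3 h4 h5 cvgFy h6 h7)).
apply: eq_integral => t; rewrite inE/= in_itv/= andbT => at0; congr EFin.
have t0 := lt_le_trans a_gt0 at0.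
rewrite !fctE derive_F// /F' ger0_norm// normal_pdf01E F_sqr ?(ltW t0)//.
rewrite [2 * t]mulrC mulfK//.
have -> : F t `^ g = 2 `^ (g / 2) * t `^ (g / 2).
  by rewrite /F powRM ?powR_ge0// -!powRrM ![2^-1 * g]mulrC.
have two0 : (2 : R) != 0 by [].
have tn0 : t != 0 by rewrite gt_eqF.
have -> : (2 : R) `^ ((g - 1) / 2) = 2 `^ (g / 2) * (2 `^ 2^-1 * 2^-1).
  have -> : (g - 1) / 2 = g / 2 + (2^-1 - 1) by field.
  by rewrite powRD ?two0 ?implybT// powRB ?two0 ?implybT// powRr1.
have -> : t `^ ((g + 1) / 2 - 1) = t `^ (g / 2) * t `^ (2^-1 - 1).
  by rewrite -powRD ?tn0 ?implybT//; congr (_ `^ _); field.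
ring.
Unshelve. all: by end_near. Qed.

End gamma_substitution.

(** By symmetry the integral is twice that over the positive half-line, which is
    exhausted by the intervals where the substitution applies. *)
Lemma integral_N01_norm_powR (g : R) : 0 < g ->
  (\int[N01]_x (`|x| `^ g)%:E =
   (1 / Num.sqrt pi * 2 `^ (g / 2) * Gamma ((g + 1) / 2))%:E)%E.
Proof.
move=> g0.
have [iG _] := integral_normal_prob (integrable_N01_norm_powR g0).
have cG : continuous (fun y : R => `|y| `^ g * phi y).
  move=> y; apply: (@continuousM R R (fun y : R => `|y| `^ g) phi).
    exact: continuous_norm_powR.
  exact: continuous_normal_pdf.
have G0 (y : R) : 0 <= `|y| `^ g * phi y.
  by rewrite mulr_ge0 ?powR_ge0 ?normal_pdf_ge0.
have mG : measurable_fun setT (fun y : R => `|y| `^ g * phi y).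
  exact: continuous_measurable_fun.
pose C : R := normal_peak 1 * 2 `^ ((g - 1) / 2).
have C0 : 0 < C by rewrite mulr_gt0 ?powR_gt0// normal_peak_gt0.
pose h (t : R) : R := t `^ ((g + 1) / 2 - 1) * expR (- t).
have h0 t : 0 <= h t by rewrite mulr_ge0 ?powR_ge0 ?expR_ge0.
have mh : measurable_fun setT h.
  apply: measurable_funM; first exact: measurable_powR.
  by apply: measurableT_comp => //; exact: oppr_measurable.
pose a (n : nat) : R := n.+1%:R^-1.
have a0 n : 0 < a n by rewrite invr_gt0.
have a_lt n m : (n <= m)%N -> a m <= a n.
  by move=> nm; rewrite lef_pV2 ?posrE ?ltr0n// ler_nat ltnS.
have a_small y : 0 < y -> exists n, a n <= y.
  move=> y0; exists (Num.bound y^-1).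
  rewrite -[leRHS]invrK lef_pV2 ?posrE ?ltr0n ?invr_gt0//.
  rewrite (le_trans (ltW (archi_boundP _))) ?invr_ge0 ?(ltW y0)//.
  by rewrite ler_nat.
have half : (\int[mu]_(y in `]0%R, +oo[) (`|y| `^ g * phi y)%:E =
    \int[mu]_(t in `]0%R, +oo[) (C * h t)%:E)%E.
  pose E n := `[half_square_inv (a n), +oo[%classic.
  pose A n := `[a n, +oo[%classic.
  have UE : \bigcup_n E n = `]0, +oo[%classic.
    apply/seteqP; split => y /=.
      move=> [n _]; rewrite /E/= !in_itv/= !andbT => /lt_le_trans; apply.
      by rewrite mulr_gt0 ?powR_gt0.
    rewrite in_itv/= andbT => y0.
    have [|n an] := a_small (y ^+ 2 / 2); first by rewrite divr_gt0// exprn_gt0.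
    exists n => //; rewrite /E/= in_itv/= andbT -(half_square_invK (ltW y0)).
    by apply: half_square_inv_le => //; exact: ltW.
  have UA : \bigcup_n A n = `]0, +oo[%classic.
    apply/seteqP; split => y /=.
      by move=> [n _]; rewrite /A/= !in_itv/= !andbT => /lt_le_trans; apply.
    rewrite in_itv/= andbT => y0; have [n an] := a_small _ y0.
    by exists n => //; rewrite /A/= in_itv/= andbT.
  have ndE : nondecreasing_seq E.
    move=> n m nm; apply/subsetPset => y; rewrite /E/= !in_itv/= !andbT.
    by apply: le_trans; apply: half_square_inv_le (a_lt _ _ nm); exact: ltW.
  have ndA : nondecreasing_seq A.
    move=> n m nm; apply/subsetPset => y; rewrite /A/= !in_itv/= !andbT.
    by apply: le_trans; exact: a_lt.
  have cE := @ge0_nondecreasing_set_cvg_integral _ (measurableTypeR R) R E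
    (fun y => (`|y| `^ g * phi y)%:E) mu ndE.
  have cA := @ge0_nondecreasing_set_cvg_integral _ (measurableTypeR R) R A
    (fun t => (C * h t)%:E) mu ndA.
  rewrite UE in cE; rewrite UA in cA.
  have mGe : measurable_fun [set: measurableTypeR R] (fun y => (`|y| `^ g * phi y)%:E).
    exact/measurable_EFinP.
  have mhe : measurable_fun [set: measurableTypeR R] (fun t => (C * h t)%:E).
    by apply/measurable_EFinP; exact: measurable_funM.
  have {}cE := cE (fun i => measurable_itv _) (fun i => measurable_funTS mGe)
    (fun i x _ => G0 x).
  have {}cA := cA (fun i => measurable_itv _) (fun i => measurable_funTS mhe)
    (fun i x _ => mulr_ge0 (ltW C0) (h0 x)).
  have EA : (fun i => \int[mu]_(x in E i) (`|x| `^ g * phi x)%:E)%E =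
            (fun i => \int[mu]_(x in A i) (C * h x)%:E)%E.
    by apply/funext => i; rewrite /E gamma_substitution.
  by rewrite EA in cE; exact: cvg_unique cE cA.
have tot : (\int[N01]_x (`|x| `^ g)%:E = (2 * C)%:E * \int[mu]_(t in `]0%R, +oo[) (h t)%:E)%E.
  have m0 : measurable_fun setT (fun x : R => (`|x| `^ g)%:E).
    apply/measurable_EFinP; apply: continuous_measurable_fun.
    exact: continuous_norm_powR.
  have p0 (x : R) : (0 <= (`|x| `^ g)%:E :> \bar R)%E by rewrite lee_fin powR_ge0.
  apply: (etrans (@ge0_integral_normal_prob R 0 1 _ p0 m0)).
  under eq_integral do rewrite -EFinM.
  have sG (x : R) : `|- x| `^ g * phi (- x) = `|x| `^ g * phi x.
    by rewrite normrN !normal_pdf01E sqrrN.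
  apply: (etrans (ge0_symfun_integralT G0 cG (fun x => esym (sG x)))).
  have -> : [set x : R | 0 <= x] = `[0, +oo[%classic.
    by apply/seteqP; split => x /=; rewrite in_itv/= andbT.
  have mG0 : measurable_fun (`]0, +oo[%classic : set (measurableTypeR R))
      (fun y => (`|y| `^ g * phi y)%:E).
    by apply/measurable_EFinP; exact: measurable_funTS.
  rewrite -(integral_itv_obnd_cbnd mG0).
  rewrite half EFinM -muleA; congr (_ * _)%E.
  rewrite -ge0_integralZl//.
  - by apply/measurable_EFinP; exact: measurable_funTS.
  - by move=> t _; rewrite lee_fin.
  - by rewrite lee_fin ltW.
have C2 : 2 * C = 1 / Num.sqrt pi * 2 `^ (g / 2).
  rewrite /C; have two0 : (2 : R) != 0 by [].
  have -> : (2 : R) `^ ((g - 1) / 2) = 2 `^ (g / 2) / 2 `^ 2^-1.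
    have -> : (g - 1) / 2 = g / 2 - 2^-1 by field.
    by rewrite powRB ?two0 ?implybT.
  rewrite powR12_sqrt// /normal_peak expr1n mul1r -(mulr_natr pi 2) sqrtrM ?pi_ge0//.
  rewrite [LHS](_ : _ = 2 / (Num.sqrt 2 * Num.sqrt 2) * (Num.sqrt pi)^-1 *
    2 `^ (g / 2)); first by rewrite -expr2 sqr_sqrtr// divff// !mul1r.
  by field; rewrite !gt_eqF ?sqrtr_gt0 ?pi_gt0.
have fin : (\int[mu]_(t in `]0%R, +oo[) (h t)%:E)%E \is a fin_num.
  rewrite ge0_fin_numE; last by apply: integral_ge0 => t _; rewrite lee_fin.
  have := integrable_fin_num measurableT (integrable_N01_norm_powR g0).
  rewrite tot; case: (\int[mu]_(t in _) _)%E => [r _|| //]; first exact: ltry.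
  by rewrite gt0_muley// lte_fin mulr_gt0.
by rewrite tot -(fineK fin) -EFinM C2.
Qed.

End absolute_moments.

(** * The reflection inequality for Gaussian walks *)

Section gaussian_walk.
Variable R : realType.
Local Notation N01 := (@normal_prob R 0 1).

Lemma measurable_exists_gt d (T : measurableType d) (X : nat -> T -> R) n (u : R) :
  (forall i, measurable_fun setT (X i)) ->
  measurable [set w | exists2 i, (i <= n)%N & u < X i w].
Proof.
move=> mX.
have -> : [set w | exists2 i, (i <= n)%N & u < X i w] =
    \bigcup_(i in [set k | (k <= n)%N]) [set w | u < X i w].
  by apply/seteqP; split => w [i /= ? ?]; exists i.
by apply: bigcup_measurable => i _; exact: measurable_gt_level.
Qed.

Lemma gauss_vec_marginal d (T : measurableType d) (P : probability T R) n
    (X : 'I_n -> T -> R) C (i : 'I_n) : gauss_vec P X C ->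
  forall c : R, gauss_vec P (fun (_ : 'I_1) w => c * X i w) (fun _ _ => c ^+ 2 * C i i).
Proof.
move=> [mX gX] c; split=> [_|a b]; first exact: measurable_funM.
have pE w : phase a b (fun=> c * X i w) =
    phase (fun j => if j == i then a ord0 * c else 0) b (X ^~ w).
  rewrite /phase big_ord1 (bigD1 i)//= eqxx big1 ?addr0 ?mulrA// => j /negbTE ->.
  by rewrite mul0r.
under eq_Rintegral do rewrite pE.
rewrite gX; congr (expR (- (_ / 2)) * _).
rewrite /quad !big_ord1 (bigD1 i)//= [X in _ + X]big1 ?addr0; last first.
  by move=> j /negbTE ->; rewrite big1// => k _; rewrite !mul0r.
rewrite (bigD1 i)//= big1 ?addr0 ?eqxx; first by ring.
by move=> j /negbTE ->; rewrite mulr0 mul0r.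
Qed.

(** In dimension one Slepian's inequality has no condition on covariances, and applies
    to X_i and - X_i, which have the same variance. *)
Lemma gauss_symmetry d (T : measurableType d) (P : probability T R) n
    (X : 'I_n -> T -> R) C (i : 'I_n) (u e : R) : gauss_vec P X C -> 0 < e ->
  (P [set w | (X i w <= u)%R] <= P [set w | (- (u + e) <= X i w)%R])%E.
Proof.
move=> gX e0.
have g1 := gauss_vec_marginal i gX 1.
have gN1 := gauss_vec_marginal i gX (-1).
have vE : (-1) ^+ 2 * C i i = 1 ^+ 2 * C i i by rewrite sqrrN.
have := slepian gN1 g1 (fun _ => vE)
  (fun (j k : 'I_1) jk => ltac:(by move: jk; rewrite (ord1 j) (ord1 k))) u e0.
have E1 : [set w | forall k : 'I_1, 1 * X i w <= u] = [set w | X i w <= u].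
  by apply/seteqP; split => w /=; rewrite mul1r => h //; exact: h ord0.
have E2 : [set w | forall k : 'I_1, -1 * X i w <= u + e] = [set w | - (u + e) <= X i w].
  by apply/seteqP; split => w /=; rewrite mulN1r lerNl => h //; exact: h ord0.
by rewrite E1 E2.
Qed.

Lemma gauss_half d (T : measurableType d) (P : probability T R) n
    (X : 'I_n -> T -> R) C (i : 'I_n) (e : R) : gauss_vec P X C -> 0 < e ->
  (1 <= 2%:E * P [set w | (- e < X i w)%R])%E.
Proof.
move=> gX e0; have [mX _] := gX.
have e20 : 0 < e / 2 by rewrite divr_gt0.
have h := gauss_symmetry i 0 gX e20.
have m1 : measurable [set w | 0 < X i w] by exact: measurable_gt_level.
have m2 : measurable [set w | - e < X i w] by exact: measurable_gt_level.
have E : [set w | X i w <= 0] = ~` [set w | 0 < X i w].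
  by apply/seteqP; split => w /=; rewrite leNgt => /negP.
rewrite E probability_setC// in h.
have h1 : (P [set w | (- (0 + e / 2) <= X i w)%R] <= P [set w | (- e < X i w)%R])%E.
  apply: le_measure; rewrite ?inE//.
    rewrite (_ : [set w | _] = ~` [set w | - X i w > e / 2]).
      apply: measurableC; apply: measurable_gt_level => //.
      exact: measurableT_comp.
    by apply/seteqP; split => w /=; rewrite add0r lerNl leNgt => /negP.
  by move=> w /=; lra.
have h2 : (P [set w | (0 < X i w)%R] <= P [set w | (- e < X i w)%R])%E.
  by apply: le_measure; rewrite ?inE// => w /=; lra.
move: h h1 h2.
rewrite -[P [set w | 0 < X i w]]fineK ?fin_num_measure//.
rewrite -[P [set w | - e < X i w]]fineK ?fin_num_measure//.
move=> /le_trans h /h; rewrite -EFinB -EFinM !lee_fin; lra.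
Qed.

(** The covariance of the partial sums of independent centered variables with standard
    deviations sigma_k. *)
Definition walk_cov (sigma : nat -> R) (i j : nat) : R :=
  \sum_(k < minn i j) sigma k ^+ 2.

(** The reflection inequality by conditioning on the first step: after a first step
    of value sigma_0 g the walk starts afresh from x + sigma_0 g, which gives the
    case x <= u by induction.  If the walk starts above u, the left side is at most 1
    and the right side is at least 1 because the last position is symmetric.
    The covariance structure is obtained by the same conditioning. *)
Lemma gaussian_walk n (sigma : nat -> R) :
  exists d (T : measurableType d) (P : probability T R) (Y : nat -> T -> R),
  [/\ forall i, measurable_fun setT (Y i),
    forall w, Y 0 w = 0,
    gauss_vec P (fun i : 'I_n.+1 => Y i) (fun i j => walk_cov sigma i j) &
    forall u x : R, (P [set w | exists2 i, (i <= n)%N & (u < x + Y i w)%R] <=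
      2%:E * P [set w | (u < x + Y n w)%R])%E].
Proof.
elim: n sigma => [|n IH] sigma.
  exists _, (measurableTypeR R), N01, (fun _ _ => 0); split => //.
  - split=> // a b; rewrite /phase.
    under eq_Rintegral do rewrite big_ord1 mulr0 add0r.
    rewrite Rintegral_probability_cst /quad !big_ord1 /walk_cov big_ord0.
    by rewrite mulr0 mul0r oppr0 expR0 mul1r.
  - move=> u x; rewrite (_ : [set w | exists2 i, _ & _] = [set w | u < x + 0]).
      by rewrite -[leLHS]mul1e lee_wpmul2r// lee_fin ler1n.
    apply/seteqP; split => w /=; first by case.
    by move=> h; exists 0%N.
have [d [T [P [Y [mY Y0 gY rY]]]]] := IH (fun k => sigma k.+1).
pose Q := (N01 \x P)%E : probability (measurableTypeR R * T)%type R.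
pose Y' (i : nat) (w : measurableTypeR R * T) : R :=
  if i is j.+1 then sigma 0 * w.1 + Y j w.2 else 0.
have mY' i : measurable_fun setT (Y' i).
  case: i => [|i]; first exact: measurable_cst.
  apply: measurable_funD; first by apply: measurable_funM => //; exact: measurable_fst.
  by apply: measurableT_comp => //; exact: measurable_snd.
have gY' : gauss_vec Q (fun i : 'I_n.+2 => Y' i) (fun i j => walk_cov sigma i j).
  split=> // a b.
  pose A : R := \sum_(i < n.+1) a (lift ord0 i).
  pose a' (i : 'I_n.+1) := a (lift ord0 i).
  have pE w : phase a b (Y' ^~ w) =
      phase a' (A * sigma 0 * w.1 + b) (fun i : 'I_n.+1 => Y i w.2).
    rewrite /phase big_ord_recl mulr0 add0r /A !mulr_suml addrA; congr (_ + b).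
    by rewrite addrC -big_split/=; apply: eq_bigr => i _; rewrite /a'; ring.
  have iF : Q.-integrable setT (EFin \o (fun w => cos (phase a b (Y' ^~ w)))).
    apply: (@bounded_integrable _ _ _ _ _ 1) => [|w]; last exact: cos_max.
    apply: measurableT_comp.
      exact: continuous_measurable_fun (@continuous_cos R).
    exact: (@measurable_phase _ _ _ _ (fun i : 'I_n.+2 => Y' i)).
  rewrite /Rintegral -integral12_prod_meas1//.
  have inner (x : R) : fubini_F P (EFin \o (fun w => cos (phase a b (Y' ^~ w)))) x =
      (expR (- (quad (fun i j : 'I_n.+1 => walk_cov (fun k => sigma k.+1) i j) a' / 2)) *
        cos (A * sigma 0 * x + b))%:E.
    rewrite /fubini_F -gY.2 -EFin_Rintegral; last first.
      apply: (@bounded_integrable _ _ _ _ _ 1) => [|w]; last exact: cos_max.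
      apply: measurableT_comp.
        exact: continuous_measurable_fun (@continuous_cos R).
      exact: (@measurable_phase _ _ _ _ (fun i : 'I_n.+1 => Y i)).
    by apply: eq_integral => w _ /=; rewrite pE.
  under eq_integral do rewrite inner.
  rewrite -/(Rintegral N01 setT (fun x => _ * cos (A * sigma 0 * x + b))).
  rewrite RintegralZl//; last first.
    apply: (@bounded_integrable _ _ _ _ _ 1) => [|w]; last exact: cos_max.
    apply: measurableT_comp.
      exact: continuous_measurable_fun (@continuous_cos R).
    by apply: measurable_funD => //; exact: measurable_funM.
  rewrite integral_N01_cos mulrA -expRD; congr (expR _ * _).
  have -> : quad (fun i j : 'I_n.+2 => walk_cov sigma i j) a =
     (A * sigma 0) ^+ 2 + quad (fun i j : 'I_n.+1 => walk_cov (fun k => sigma k.+1) i j) a'.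
    rewrite /quad big_ord_recl [X in X + _]big1 ?add0r; last first.
      by move=> j _; rewrite /walk_cov min0n big_ord0 mulr0.
    rewrite /= exprMn [A ^+ 2]expr2 {1}/A !mulr_suml -big_split/=.
    apply: eq_bigr => i _; rewrite big_ord_recl/= [X in X + _](_ : _ = 0) ?add0r; last first.
      by rewrite /walk_cov minn0 big_ord0 mulr0.
    rewrite mulr_sumr mulr_suml -big_split/=; apply: eq_bigr => j _.
    by rewrite /walk_cov minnSS big_ord_recl /= /a'; ring.
  by field.
exists _, (measurableTypeR R * T)%type, Q, Y'; split => // u x.
have mE : measurable [set w | exists2 i, (i <= n.+1)%N & u < x + Y' i w].
  apply: measurable_exists_gt (fun i w => x + Y' i w) _ _ _ => i.
  exact: measurable_funD.
have [ux|xu] := ltP u x.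
  have := gauss_half ord_max gY' (_ : 0 < x - u).
  rewrite subr_gt0 ux => /(_ isT).
  rewrite (_ : [set w | - (x - u) < _] = [set w | u < x + Y' n.+1 w]).
    by apply: le_trans; exact: probability_le1.
  by apply/seteqP; split => w /=; lra.
have mE' : measurable [set w | u < x + Y' n.+1 w].
  by apply: measurable_gt_level; exact: measurable_funD.
have QE S : Q S = (\int[N01]_g P (xsection S g))%E by [].
rewrite !QE -ge0_integralZl//; last exact: measurable_fun_xsection.
apply: ge0_le_integral => //.
- exact: measurable_fun_xsection.
- by apply: measurable_funeM; exact: measurable_fun_xsection.
move=> g _.
have -> : xsection [set w | exists2 i, (i <= n.+1)%N & u < x + Y' i w] g =
    [set w | exists2 i, (i <= n)%N & u < x + sigma 0 * g + Y i w].
  apply/seteqP; split => w; rewrite /xsection/= inE/=.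
    move=> [[|i] /= ni]; first by rewrite addr0 ltNge xu.
    by rewrite addrA => h; exists i.
  by move=> [i ni h]; exists i.+1 => //=; rewrite addrA.
have -> : xsection [set w | u < x + Y' n.+1 w] g = [set w | u < x + sigma 0 * g + Y n w].
  by apply/seteqP; split => w; rewrite /xsection/= inE/= addrA.
exact: rY.
Qed.

End gaussian_walk.

(** * The maximum of a Gaussian vector *)

Lemma probability_setC_le d (T : measurableType d) d' (T' : measurableType d')
    (R : realType) (P : probability T R) (P' : probability T' R) (A : set T)
    (A' : set T') : measurable A -> measurable A' ->
  (P' A' <= P A)%E -> (P (~` A) <= P' (~` A'))%E.
Proof.
by move=> mA mA' h; rewrite !probability_setC// leeB.
Qed.

Section maximal_inequality.
Context d (T : measurableType d) (R : realType) (P : probability T R).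

Lemma exists_gtE d' (T' : measurableType d') (X : nat -> T' -> R) n (u : R) :
  [set w | exists2 i, (i <= n)%N & u < X i w] =
  ~` [set w | forall k : 'I_n.+1, X k w <= u].
Proof.
apply/seteqP; split => w /=.
  by move=> [i ni ui] /(_ (Ordinal (ni : i < n.+1)%N)) /=; rewrite leNgt ui.
move=> h; apply: contrapT => h'; apply: h => k; rewrite leNgt; apply/negP => uk.
by apply: h'; exists k => //; rewrite -ltnS.
Qed.

Lemma gt_levelE d' (T' : measurableType d') (X : T' -> R) (u : R) :
  [set w | u < X w] = ~` [set w | forall k : 'I_1, 1 * X w <= u].
Proof.
apply/seteqP; split => w /=.
  by move=> uX /(_ ord0); rewrite mul1r leNgt uX.
by move=> h; rewrite ltNge; apply/negP => Xu; apply: h => _; rewrite mul1r.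
Qed.

(** Slepian's inequality is used twice: in dimension n + 1 to pass from X to the walk,
    and in dimension one to return from the last position of the walk to X_n.  The
    gap between v and u pays for the two level shifts. *)
Lemma gauss_max_tail n (X : nat -> T -> R) (C : 'I_n.+1 -> 'I_n.+1 -> R)
    (sigma : nat -> R) :
  gauss_vec P (fun i : 'I_n.+1 => X i) C -> (forall i, measurable_fun setT (X i)) ->
  (forall i : 'I_n.+1, C i i = walk_cov sigma i i) ->
  (forall i j : 'I_n.+1, i != j -> walk_cov sigma i j <= C i j) ->
  forall u v : R, v < u ->
  (P [set w | exists2 i, (i <= n)%N & (u < X i w)%R] <=
   2%:E * P [set w | (v < X n w)%R])%E.
Proof.
move=> gX mX eqv lecov u v vu.
have [d' [T' [P' [Y [mY _ gY rY]]]]] := gaussian_walk n sigma.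
pose e := (u - v) / 2; have e0 : 0 < e by rewrite divr_gt0// subr_gt0.
have ue : u = v + e + e by rewrite /e; field.
have max_le : (P [set w | exists2 i, (i <= n)%N & (u < X i w)%R] <=
    P' [set w | exists2 i, (i <= n)%N & (v + e < Y i w)%R])%E.
  rewrite !exists_gtE; apply: probability_setC_le.
  - exact: (@measurable_all_le _ _ _ _ (fun i : 'I_n.+1 => X i)).
  - exact: (@measurable_all_le _ _ _ _ (fun i : 'I_n.+1 => Y i)).
  by rewrite ue; exact: slepian gX gY eqv lecov _ _ e0.
have end_le : (P' [set w | (v + e < Y n w)%R] <= P [set w | (v < X n w)%R])%E.
  have gX1 := gauss_vec_marginal ord_max gX 1.
  have gY1 := gauss_vec_marginal ord_max gY 1.
  have eqv1 : 1 ^+ 2 * walk_cov sigma (@ord_max n) (@ord_max n) =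
    1 ^+ 2 * C ord_max ord_max by rewrite eqv.
  rewrite !gt_levelE; apply: probability_setC_le.
  - exact: (@measurable_all_le _ _ _ _ (fun (i : 'I_1) w => 1 * Y n w) (gY1.1)).
  - exact: (@measurable_all_le _ _ _ _ (fun (i : 'I_1) w => 1 * X n w) (gX1.1)).
  apply: (slepian gY1 gX1 (fun _ => eqv1) _ _ e0) => j k.
  by rewrite (ord1 j) (ord1 k).
apply: (le_trans max_le); have := rY (v + e) 0.
rewrite (_ : [set w | exists2 i, (i <= n)%N & _ < 0 + _] =
  [set w | exists2 i, (i <= n)%N & (v + e < Y i w)%R]); last first.
  by apply/seteqP; split => w /= [i]; [rewrite add0r|rewrite -[Y i w]add0r]; exists i.
rewrite (_ : [set w | _ < 0 + Y n w] = [set w | v + e < Y n w]); last first.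
  by apply/seteqP; split => w /=; rewrite add0r.
by move=> /le_trans; apply; rewrite lee_wpmul2l// lee_fin.
Qed.

Lemma gauss_vecN n (X : 'I_n -> T -> R) C : gauss_vec P X C ->
  gauss_vec P (fun i w => - X i w) C.
Proof.
move=> [mX gX]; split=> [i|a b]; first exact: measurableT_comp.
have pE w : phase a b (fun i => - X i w) = phase (fun i => - a i) b (X ^~ w).
  by rewrite /phase; under eq_bigr do rewrite mulrN -mulNr.
under eq_Rintegral do rewrite pE.
rewrite gX /quad; congr (expR (- (_ / 2)) * _).
by apply: eq_bigr => i _; apply: eq_bigr => j _; rewrite mulrNN.
Qed.

(** A union bound over X and - X; as v >= 0 the final events are disjoint, so the
    factor 2 is preserved. *)
Lemma gauss_max_norm_tail n (X : nat -> T -> R) (C : 'I_n.+1 -> 'I_n.+1 -> R)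
    (sigma : nat -> R) :
  gauss_vec P (fun i : 'I_n.+1 => X i) C -> (forall i, measurable_fun setT (X i)) ->
  (forall i : 'I_n.+1, C i i = walk_cov sigma i i) ->
  (forall i j : 'I_n.+1, i != j -> walk_cov sigma i j <= C i j) ->
  forall u v : R, 0 <= v -> v < u ->
  (P [set w | exists2 i, (i <= n)%N & (u < `|X i w|)%R] <=
   2%:E * P [set w | (v < `|X n w|)%R])%E.
Proof.
move=> gX mX eqv lecov u v v0 vu.
have mNX i : measurable_fun setT (fun w => - X i w) by exact: measurableT_comp.
have hX := gauss_max_tail gX mX eqv lecov vu.
have hNX := gauss_max_tail (X := fun i w => - X i w) (gauss_vecN gX) mNX eqv lecov vu.
rewrite (_ : [set w | exists2 i, _ & u < `|X i w|] =
  [set w | exists2 i, (i <= n)%N & u < X i w] `|`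
  [set w | exists2 i, (i <= n)%N & u < - X i w]); last first.
  apply/seteqP; split => w /=.
    by move=> [i ni]; rewrite ltr_normr => /orP[]; [left|right]; exists i.
  by move=> [|] [i ni h]; exists i => //; rewrite ltr_normr h ?orbT.
rewrite (_ : [set w | v < `|X n w|] =
  [set w | v < X n w] `|` [set w | v < - X n w]); last first.
  apply/seteqP; split => w /=; rewrite ltr_normr; first by move/orP.
  by move=> [] ->; rewrite ?orbT.
have mE (Z : nat -> T -> R) : (forall i, measurable_fun setT (Z i)) ->
    measurable [set w | exists2 i, (i <= n)%N & u < Z i w].
  by move=> mZ; exact: measurable_exists_gt.
apply: (le_trans (measureU2 _ (mE _ mX) (mE _ mNX))).
rewrite measureU; [|exact: measurable_gt_level..|].
  by rewrite ge0_muleDr//; exact: leeD hX hNX.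
by apply/seteqP; split => w //= []; lra.
Qed.

(** The layer-cake formula; the single level r = 0 is negligible. *)
Lemma le_expectation_of_tail (Z W : T -> R) (k : R) :
  measurable_fun setT Z -> measurable_fun setT W ->
  (forall w, 0 <= Z w) -> (forall w, 0 <= W w) -> 0 <= k ->
  (forall r, 0 < r -> (P [set w | (r < Z w)%R] <= k%:E * P [set w | (r < W w)%R])%E) ->
  (\int[P]_w (Z w)%:E <= k%:E * \int[P]_w (W w)%:E)%E.
Proof.
move=> mZ mW Z0 W0 k0 h.
pose Zr : {RV P >-> R} := HB.pack Z (isMeasurableFun.Build _ _ _ _ _ mZ).
pose Wr : {RV P >-> R} := HB.pack W (isMeasurableFun.Build _ _ _ _ _ mW).
have ccdfE (Y : {RV P >-> R}) : (forall w, 0 <= Y w) ->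
    (\int[P]_w (Y w)%:E)%E =
    (\int[@lebesgue_measure R]_(r in `]0%R, +oo[) ccdf Y r)%E.
  move=> Y0; have := ge0_expectation_ccdf Y0; rewrite expectation_def => ->.
  rewrite -integral_itv_obnd_cbnd//; apply: measurable_funTS; exact: ccdf_measurable.
have mccdf (Y : {RV P >-> R}) :
    measurable_fun (`]0, +oo[%classic : set (measurableTypeR R)) (ccdf Y).
  by apply: measurable_funTS; exact: ccdf_measurable.
rewrite (ccdfE Zr Z0) (ccdfE Wr W0) -ge0_integralZl//.
apply: ge0_le_integral => //.
  exact: measurable_funeM.
move=> r /=; rewrite in_itv/= andbT => r0; have := h r r0.
have ccE (Y : {RV P >-> R}) : ccdf Y r = P [set w | r < Y w].
  rewrite /ccdf/= /distribution /pushforward; congr (P _).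
  by apply/seteqP; split => w /=; rewrite in_itv/= andbT.
by rewrite !ccE.
Qed.

End maximal_inequality.

Section maximal_moment.
Context d (T : measurableType d) (R : realType) (P : probability T R).

(** The base value 0 is harmless because norms are nonnegative. *)
Definition max_norm n (X : nat -> T -> R) (w : T) : R :=
  \big[Num.max/0]_(i < n.+1) `|X i w|.

Lemma max_norm_ge0 n X w : 0 <= max_norm n X w.
Proof. exact: bigmax_ge_id. Qed.

Lemma measurable_max_norm n X : (forall i, measurable_fun setT (X i)) ->
  measurable_fun setT (max_norm n X).
Proof.
move=> mX; rewrite /max_norm.
elim: n.+1 X mX => [|m IH] X mX.
  by under eq_fun do rewrite big_ord0; exact: measurable_cst.
under eq_fun do rewrite big_ord_recl/=.
apply: measurable_maxr; first exact: measurableT_comp.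
exact: (IH (fun i => X i.+1)).
Qed.

Lemma max_norm_gt n X w u : 0 <= u ->
  (u < max_norm n X w) <-> exists2 i, (i <= n)%N & u < `|X i w|.
Proof.
move=> u0; split.
  move=> h; apply: contrapT => h'; move: h; rewrite ltNge => /negP; apply.
  apply: bigmax_le => // i _; rewrite leNgt; apply/negP => ui.
  by apply: h'; exists i => //; rewrite -ltnS.
move=> [i ni ui]; apply: (lt_le_trans ui).
exact: (@le_bigmax _ _ _ 0 (fun i : 'I_n.+1 => `|X i w|) (Ordinal (ni : i < n.+1)%N)).
Qed.

Lemma measurable_powR_fun (f : T -> R) (g : R) : measurable_fun setT f ->
  measurable_fun setT (fun w => f w `^ g).
Proof. by move=> mf; exact: (measurableT_comp (measurable_powR g) mf). Qed.

(** The factor l > 1 leaves the room between the two levels of the tail estimate. *)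
Lemma gauss_max_moment n (X : nat -> T -> R) (C : 'I_n.+1 -> 'I_n.+1 -> R)
    (sigma : nat -> R) :
  gauss_vec P (fun i : 'I_n.+1 => X i) C -> (forall i, measurable_fun setT (X i)) ->
  (forall i : 'I_n.+1, C i i = walk_cov sigma i i) ->
  (forall i j : 'I_n.+1, i != j -> walk_cov sigma i j <= C i j) ->
  forall g l : R, 0 < g -> 1 < l ->
  (\int[P]_w (max_norm n X w `^ g)%:E <=
   2%:E * \int[P]_w ((l * `|X n w|) `^ g)%:E)%E.
Proof.
move=> gX mX eqv lecov g l g0 l1.
have l0 : 0 < l by rewrite (lt_trans _ l1).
have mA : measurable_fun setT (fun w => l * `|X n w|).
  by apply: measurable_funM => //; exact: measurableT_comp.
apply: le_expectation_of_tail => //.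
- by apply: measurable_powR_fun; exact: measurable_max_norm.
- exact: measurable_powR_fun.
- by move=> w; rewrite powR_ge0.
- by move=> w; rewrite powR_ge0.
move=> r r0; pose u := r `^ g^-1.
have u0 : 0 < u by rewrite powR_gt0.
have rE : r = u `^ g by rewrite /u -powRrM mulVf ?gt_eqF// powRr1// ltW.
(* The level u satisfies u^g = r. *)
have ltE x : 0 <= x -> (r < x `^ g) = (u < x).
  move=> x0; rewrite rE; have [ux|xu] := ltP u x.
    by rewrite gt0_ltr_powR// nnegrE ltW.
  by apply/negbTE; rewrite -leNgt; apply: ge0_ler_powR; rewrite ?nnegrE ?(ltW g0) ?(ltW u0).
rewrite (_ : [set w | _ < max_norm n X w `^ g] =
    [set w | exists2 i, (i <= n)%N & u < `|X i w|]); last first.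
  apply/seteqP; split => w /=; rewrite ltE ?max_norm_ge0//.
    by move/max_norm_gt; apply; exact: ltW.
  by move=> h; apply/max_norm_gt => //; exact: ltW.
rewrite (_ : [set w | _ < (l * `|X n w|) `^ g] = [set w | u / l < `|X n w|]); last first.
  apply/seteqP; split => w /=; rewrite ltE ?mulr_ge0 ?(ltW l0)//.
    by rewrite ltr_pdivrMr// mulrC.
  by rewrite ltr_pdivrMr// mulrC.
apply: gauss_max_norm_tail gX mX eqv lecov _ _ _ _.
  by rewrite divr_ge0 ?ltW.
by rewrite ltr_pdivrMr// ltr_pMr.
Qed.

End maximal_moment.

(** * The covariance of fractional Brownian motion *)

Section powR_superadditive.
Variable R : realType.

(** a^p = a a^(p-1) <= a (a+b)^(p-1), and likewise for b. *)
Lemma powR_superadditive (p a b : R) : 1 <= p -> 0 <= a -> 0 <= b ->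
  a `^ p + b `^ p <= (a + b) `^ p.
Proof.
move=> p1 a0 b0; have p0 : 0 < p by rewrite (lt_le_trans _ p1).
have split_pow (x : R) : 0 <= x -> x `^ p = x * x `^ (p - 1).
  move=> x0; have [->|xn0] := eqVneq x 0; first by rewrite powR0 ?mul0r ?gt_eqF.
  rewrite -[X in X * _]powRr1// -powRD ?xn0 ?implybT//; congr (_ `^ _); ring.
rewrite (split_pow a)// (split_pow b)// (split_pow (a + b)) ?addr_ge0// mulrDl.
have q0 : 0 <= p - 1 by rewrite subr_ge0.
have ab0 : 0 <= a + b by rewrite addr_ge0.
apply: lerD; apply: ler_wpM2l => //; apply: ge0_ler_powR => //.
  by rewrite lerDl.
by rewrite lerDr.
Qed.

End powR_superadditive.

Section law_transfer.
Context d (T : measurableType d) (R : realType) (P : probability T R).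

Lemma integral_eq_law (X Y : T -> R) (f : R -> R) :
  measurable_fun setT X -> measurable_fun setT Y ->
  (forall A : set R, measurable A -> pushforward P X A = pushforward P Y A) ->
  measurable_fun setT f -> (forall x, 0 <= f x) ->
  (\int[P]_w (f (X w))%:E = \int[P]_w (f (Y w))%:E)%E.
Proof.
move=> mX mY XY mf f0.
have mX' : measurable_fun setT (X : T -> measurableTypeR R) by exact: mX.
have mY' : measurable_fun setT (Y : T -> measurableTypeR R) by exact: mY.
pose Xm : {mfun T >-> measurableTypeR R} :=
  HB.pack (X : T -> measurableTypeR R) (isMeasurableFun.Build _ _ _ _ _ mX').
pose Ym : {mfun T >-> measurableTypeR R} :=
  HB.pack (Y : T -> measurableTypeR R) (isMeasurableFun.Build _ _ _ _ _ mY').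
have mfe : measurable_fun [set: measurableTypeR R] (EFin \o f).
  exact/measurable_EFinP.
have fe0 (y : R) : (0 <= (f y)%:E)%E by rewrite lee_fin.
have pX := @ge0_integral_pushforward _ _ _ _ _ Xm mX' P setT (EFin \o f)
  measurableT mfe (fun y _ => fe0 y).
have pY := @ge0_integral_pushforward _ _ _ _ _ Ym mY' P setT (EFin \o f)
  measurableT mfe (fun y _ => fe0 y).
rewrite !preimage_setT in pX pY.
apply: (etrans (esym pX)); apply: etrans pY.
by apply: (@eq_measure_integral _ _ _ _ (distribution P Ym)) => A mA _; exact: XY.
Qed.

Lemma real_integrable_sum n (f : 'I_n -> T -> R) :
  (forall i, P.-integrable setT (EFin \o f i)) ->
  P.-integrable setT (EFin \o (fun w => \sum_i f i w)) /\
  \int[P]_w (\sum_i f i w) = \sum_i \int[P]_w f i w.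
Proof.
elim: n f => [|n IH] f fi.
  under eq_fun do rewrite big_ord0.
  split; first exact: finite_measure_integrable_cst.
  by rewrite big_ord0 Rintegral_probability_cst.
have [i1 e1] := IH (fun i => f (lift ord0 i)) (fun i => fi _).
under eq_fun do rewrite big_ord_recl.
split; first exact: real_integrableD.
by rewrite RintegralD// e1 big_ord_recl.
Qed.

Lemma real_integrable_mul (X Y : T -> R) :
  measurable_fun setT X -> measurable_fun setT Y ->
  P.-integrable setT (EFin \o (fun w => X w ^+ 2)) ->
  P.-integrable setT (EFin \o (fun w => Y w ^+ 2)) ->
  P.-integrable setT (EFin \o (fun w => X w * Y w)).
Proof.
move=> mX mY iX iY.
apply: (le_integrable measurableT _ _ (real_integrableD iX iY)).
  by apply/measurable_EFinP; exact: measurable_funM.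
move=> w _ /=; rewrite lee_fin [leRHS]ger0_norm ?addr_ge0 ?sqr_ge0// normrM.
rewrite -(real_normK (num_real (X w))) -(real_normK (num_real (Y w))).
by move: `|X w| `|Y w| => x y; nra.
Qed.

Lemma real_integrable_of_sqr (X : T -> R) : measurable_fun setT X ->
  P.-integrable setT (EFin \o (fun w => X w ^+ 2)) -> P.-integrable setT (EFin \o X).
Proof.
move=> mX iX.
have i1 : P.-integrable setT (EFin \o (fun w : T => (1 : R) ^+ 2)).
  exact: finite_measure_integrable_cst.
have := real_integrable_mul mX (@measurable_cst _ _ _ _ setT (1 : R)) iX i1.
by under eq_fun do rewrite mulr1.
Qed.

End law_transfer.

Section fbm_covariance.
Context d (Omega : measurableType d) (R : realType) (P : probability Omega R).
Variables (H : R) (B : R -> {RV P >-> R}).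
Hypotheses (H_gt0 : 0 < H) (fbmB : fractional_brownian_motion H B).

Definition cov (s t : R) : R := \int[P]_w (B s w * B t w).

Let mB t : measurable_fun setT (B t).
Proof. exact: measurable_funPT. Qed.

Let gaussian_B t : 0 <= t -> gaussian_rv P (B t).
Proof.
move=> t0; have := fbm_gaussian fbmB (fun _ : 'I_1 => 1) (fun _ : 'I_1 => t0).
by congr gaussian_rv; apply/funext => w; rewrite big_ord1 mul1r.
Qed.

Let integrable_sqr t : 0 <= t -> P.-integrable setT (EFin \o (fun w => B t w ^+ 2)).
Proof.
move=> t0.
by have [s []] := centered_gaussian (mB t) (gaussian_B t0) (fbm_centered fbmB t0).
Qed.

Let integrable_mul s t : 0 <= s -> 0 <= t ->
  P.-integrable setT (EFin \o (fun w => B s w * B t w)).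
Proof.
by move=> s0 t0; apply: real_integrable_mul => //; exact: integrable_sqr.
Qed.

Let integrable_B t : 0 <= t -> P.-integrable setT (EFin \o B t).
Proof. by move=> t0; apply: real_integrable_of_sqr => //; exact: integrable_sqr. Qed.

Let mean_B t : 0 <= t -> \int[P]_w B t w = 0.
Proof.
by move=> t0; have := fbm_centered fbmB t0; rewrite expectation_def /Rintegral => ->.
Qed.

Lemma fbm_cov_diag t : 0 <= t -> cov t t = t `^ (2 * H).
Proof.
move=> t0; have := fbm_variance fbmB t0.
rewrite /variance covariance.unlock (fbm_centered fbmB t0) expectation.unlock /=.
rewrite /cov /Rintegral => /(congr1 fine) /= <-; congr fine.
by apply: eq_integral => w _; rewrite !fctE/= !subr0.
Qed.

Lemma fbm_cov_comb n (a t : 'I_n -> R) : (forall i, 0 <= t i) ->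
  \int[P]_w (\sum_i a i * B (t i) w) ^+ 2 = quad (fun i j => cov (t i) (t j)) a.
Proof.
move=> t0.
have E w : (\sum_i a i * B (t i) w) ^+ 2 =
    \sum_i \sum_j a i * a j * (B (t i) w * B (t j) w).
  rewrite expr2 mulr_suml; apply: eq_bigr => i _; rewrite mulr_sumr.
  by apply: eq_bigr => j _; ring.
under eq_Rintegral do rewrite E.
have iij i j : P.-integrable setT (EFin \o (fun w => a i * a j * (B (t i) w * B (t j) w))).
  by apply: real_integrableZl; exact: integrable_mul.
rewrite (real_integrable_sum (fun i => (real_integrable_sum (iij i)).1)).2.
apply: eq_bigr => i _; rewrite (real_integrable_sum (iij i)).2.
by apply: eq_bigr => j _; rewrite RintegralZl//; exact: integrable_mul.
Qed.

Lemma fbm_cov_sqr_comb (a b s t : R) : 0 <= s -> 0 <= t ->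
  \int[P]_w (a * B s w + b * B t w) ^+ 2 =
  a ^+ 2 * cov s s + 2 * (a * b) * cov s t + b ^+ 2 * cov t t.
Proof.
move=> s0 t0.
have i1 : P.-integrable setT (EFin \o (fun w => a ^+ 2 * (B s w * B s w))).
  by apply: real_integrableZl; exact: integrable_mul.
have i2 : P.-integrable setT (EFin \o (fun w => 2 * (a * b) * (B s w * B t w))).
  by apply: real_integrableZl; exact: integrable_mul.
have i3 : P.-integrable setT (EFin \o (fun w => b ^+ 2 * (B t w * B t w))).
  by apply: real_integrableZl; exact: integrable_mul.
have E w : (a * B s w + b * B t w) ^+ 2 = a ^+ 2 * (B s w * B s w) +
    2 * (a * b) * (B s w * B t w) + b ^+ 2 * (B t w * B t w) by ring.
under eq_Rintegral do rewrite E.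
rewrite RintegralD//; last exact: real_integrableD.
by rewrite RintegralD// !RintegralZl//; exact: integrable_mul.
Qed.

(** B_0 has zero variance, so E (c B_0 + B_t)^2 is an affine function of c; being
    nonnegative, it has slope 0. *)
Lemma fbm_cov0 t : 0 <= t -> cov 0 t = 0.
Proof.
move=> t0; apply/eqP; apply: contraT => q0.
have K0 : cov 0 0 = 0 by rewrite fbm_cov_diag// powR0// mulf_neq0// gt_eqF.
(* At this c the affine function takes the value -1. *)
pose c := - (cov t t + 1) / (2 * cov 0 t).
have := fbm_cov_sqr_comb c 1 (lexx 0) t0.
have -> : c ^+ 2 * cov 0 0 + 2 * (c * 1) * cov 0 t + 1 ^+ 2 * cov t t = -1.
  by rewrite K0 /c; field.
move=> E; have : 0 <= \int[P]_w (c * B 0 w + 1 * B t w) ^+ 2.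
  by apply: Rintegral_ge0 => w _; exact: sqr_ge0.
by rewrite E; lra.
Qed.

(** Stationarity of the increments is used through one-point marginals only. *)
Lemma fbm_increment_sqr s t : 0 <= s -> s <= t ->
  \int[P]_w (B t w - B s w) ^+ 2 = (t - s) `^ (2 * H).
Proof.
move=> s0 st; have h0 : 0 <= t - s by rewrite subr_ge0.
have mD u v : measurable_fun setT (fun w => B u w - B v w) by exact: measurable_funB.
have law (A : set R) : measurable A ->
    pushforward P (fun w => B t w - B s w) A =
    pushforward P (fun w => B (t - s) w - B 0 w) A.
  move=> mA.
  have mA1 : measurable [set x : 1.-tuple R | A (tnth x ord0)].
    by rewrite -[X in measurable X]setTI; exact: measurable_tnth.
  have := fbm_stationary fbmB s0 (fun _ : 'I_1 => h0) mA1.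
  by rewrite /pushforward /preimage/=; under eq_set do rewrite tnth_mktuple subrK;
    under [in X in _ = X -> _]eq_set do rewrite tnth_mktuple.
have := integral_eq_law (mD _ _) (mD _ _) law
  (measurable_funX 2 (@measurable_id _ _ setT)) (fun x => sqr_ge0 x).
move=> /(congr1 fine); rewrite -!/(Rintegral _ _ _) => ->.
have := fbm_cov_sqr_comb (-1) 1 (lexx 0) h0.
rewrite (fbm_cov0 h0) (fbm_cov0 (lexx 0)) (fbm_cov_diag h0).
rewrite !mulr0 !add0r expr1n mul1r => <-.
by apply: eq_Rintegral => w _; congr (_ ^+ 2); ring.
Qed.

Lemma fbm_covE s t : 0 <= s -> s <= t ->
  cov s t = (s `^ (2 * H) + t `^ (2 * H) - (t - s) `^ (2 * H)) / 2.
Proof.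
move=> s0 st; have t0 := le_trans s0 st.
have := fbm_cov_sqr_comb (-1) 1 s0 t0; rewrite !fbm_cov_diag//.
rewrite -(fbm_increment_sqr s0 st).
have -> : \int[P]_w (-1 * B s w + 1 * B t w) ^+ 2 = \int[P]_w (B t w - B s w) ^+ 2.
  by apply: eq_Rintegral => w _; congr (_ ^+ 2); ring.
lra.
Qed.

(** The comparison with the walk of the same variances, and the only place where
    H >= 1/2 matters. *)
Lemma fbm_cov_ge s t : 1 / 2 <= H -> 0 <= s -> s <= t -> s `^ (2 * H) <= cov s t.
Proof.
move=> H2 s0 st; rewrite fbm_covE//.
have := @powR_superadditive R (2 * H) s (t - s).
have -> : s + (t - s) = t by ring.
have H1 : 1 <= 2 * H by lra.
by rewrite subr_ge0 => /(_ H1 s0 st); lra.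
Qed.

Lemma covC s t : cov s t = cov t s.
Proof. by apply: eq_Rintegral => w _; rewrite mulrC. Qed.

(** Every linear combination is centered Gaussian with variance the quadratic form of
    the covariance matrix. *)
Lemma fbm_gauss_vec n (t : 'I_n -> R) : (forall i, 0 <= t i) ->
  gauss_vec P (fun i => B (t i)) (fun i j => cov (t i) (t j)).
Proof.
move=> t0; split=> // a b.
pose Z w := \sum_i a i * B (t i) w.
have mZ : measurable_fun setT Z by apply: measurable_sum => i; exact: measurable_funM.
have iZ : P.-integrable setT (EFin \o Z) /\ \int[P]_w Z w = 0.
  have ii i : P.-integrable setT (EFin \o (fun w => a i * B (t i) w)).
    by apply: real_integrableZl; exact: integrable_B.
  have [iZ e] := real_integrable_sum ii; split=> //.
  rewrite e big1// => i _; rewrite RintegralZl ?mean_B ?mulr0//.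
  exact: integrable_B.
have EZ : ('E_P[Z] = 0)%E by rewrite expectation.unlock (EFin_Rintegral iZ.1) iZ.2.
have [s [s0 _ s2 tr]] := centered_gaussian mZ (fbm_gaussian fbmB a t0) EZ.
by rewrite -(fbm_cov_comb a t0) s2; exact: centered_gaussian_cos.
Qed.

Lemma fbm_norm_moment t (g : R) : 0 <= t -> 0 < g ->
  (\int[P]_w (`|B t w| `^ g)%:E =
   (t `^ (g * H) * (1 / Num.sqrt pi * 2 `^ (g / 2) * Gamma ((g + 1) / 2)))%:E)%E.
Proof.
move=> t0 g0.
have [s [s0 _ s2 tr]] := centered_gaussian (mB t) (gaussian_B t0) (fbm_centered fbmB t0).
have sE : s = t `^ H.
  have : s ^+ 2 = (t `^ H) ^+ 2.
    rewrite -s2 -powR_mulrn ?powR_ge0// -powRrM mulrC -fbm_cov_diag//.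
  by move=> /eqP; rewrite eqrXn2// ?powR_ge0// => /eqP.
rewrite (tr (fun x => `|x| `^ g)); first last.
- by move=> x; rewrite powR_ge0.
- exact: continuous_norm_powR.
under eq_integral => x _ do rewrite normrM powRM// (ger0_norm s0) EFinM.
rewrite ge0_integralZl//; first last.
- by rewrite lee_fin powR_ge0.
- apply/measurable_EFinP; apply: continuous_measurable_fun.
  exact: continuous_norm_powR.
by rewrite integral_N01_norm_powR// -EFinM sE -powRrM [H * g]mulrC.
Qed.

End fbm_covariance.

(** * The supremum of fractional Brownian motion *)

Section dyadic_maximum.
Variables (R : realType) (T : R).
Hypothesis T_gt0 : 0 < T.

Definition dyadic (m i : nat) : R := T * (i%:R / (2 ^ m)%:R).

Let pow2_gt0 m : (0 : R) < (2 ^ m)%:R.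
Proof. by rewrite ltr0n expn_gt0. Qed.

Lemma dyadic_ge0 m i : 0 <= dyadic m i.
Proof. by rewrite mulr_ge0 ?divr_ge0 ?(ltW T_gt0). Qed.

Lemma dyadic_le m i j : (i <= j)%N -> dyadic m i <= dyadic m j.
Proof. by move=> ij; rewrite ler_pM2l// ler_pM2r ?invr_gt0// ler_nat. Qed.

Lemma dyadic0 m : dyadic m 0 = 0.
Proof. by rewrite /dyadic mul0r mulr0. Qed.

Lemma dyadic_last m : dyadic m (2 ^ m) = T.
Proof. by rewrite /dyadic divff ?mulr1// gt_eqF. Qed.

Lemma dyadic_double m i : dyadic m.+1 (2 * i) = dyadic m i.
Proof.
by rewrite /dyadic expnS !natrM; field; rewrite gt_eqF.
Qed.

Lemma dyadic_near m (c : R) : c \in `[0, T] ->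
  exists2 i, (i <= 2 ^ m)%N & `|c - dyadic m i| <= T / (2 ^ m)%:R.
Proof.
rewrite in_itv/= => /andP[c0 cT].
have ex : exists i, c <= dyadic m i by exists (2 ^ m)%N; rewrite dyadic_last.
case: (ex_minnP ex) => i ci imin.
exists i; first by apply: imin; rewrite dyadic_last.
case: i ci imin => [|i] ci imin.
  have -> : c = 0 by apply/eqP; rewrite eq_le c0 -(dyadic0 m) ci.
  by rewrite dyadic0 subrr normr0 divr_ge0 ?(ltW T_gt0).
have ic : dyadic m i < c.
  by rewrite ltNge; apply/negP => /imin; rewrite ltnn.
have E : dyadic m i.+1 = dyadic m i + T / (2 ^ m)%:R.
  by rewrite /dyadic -(@natr1 R i) mulrDl mulrDr mul1r.
rewrite ler_norml; move: ci ic; rewrite E; have := pow2_gt0 m; lra.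
Qed.

Variable f : R -> R.
Hypothesis cf : {within `[0, T], continuous f}.

Definition dyadic_max m : R := \big[Num.max/0]_(i < (2 ^ m).+1) `|f (dyadic m i)|.

Let le_dyadic_max m i : (i <= 2 ^ m)%N -> `|f (dyadic m i)| <= dyadic_max m.
Proof.
move=> im; exact: (@le_bigmax _ _ _ 0
  (fun i : 'I_(2 ^ m).+1 => `|f (dyadic m i)|) (Ordinal (im : i < (2 ^ m).+1)%N)).
Qed.

Lemma dyadic_max_ge_last m : `|f T| <= dyadic_max m.
Proof. by rewrite -{1}(dyadic_last m); exact: le_dyadic_max. Qed.

Lemma dyadic_max_ge0 m : 0 <= dyadic_max m.
Proof. exact: bigmax_ge_id. Qed.

Lemma dyadic_max_nondecreasing m n : (m <= n)%N -> dyadic_max m <= dyadic_max n.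
Proof.
move=> /subnK <-; elim: (n - m)%N => [//|k IH]; apply: (le_trans IH).
rewrite addSn; apply: bigmax_le => [|i _]; first exact: dyadic_max_ge0.
rewrite -dyadic_double; apply: le_dyadic_max.
by rewrite expnS leq_mul2l/= -ltnS.
Qed.

Lemma sup_norm_attained : exists2 c, c \in `[0, T] &
  sup [set `|f t| | t in `[0, T]] = `|f c| /\
  forall t, t \in `[0, T] -> `|f t| <= `|f c|.
Proof.
have cnf : {within `[0, T], continuous (fun t => `|f t|)}.
  apply/subspace_continuousP => x xT; apply: cvg_norm.
  by move/subspace_continuousP : cf; apply.
have [c cT cmax] := EVT_max (ltW T_gt0) cnf.
exists c => //; split=> //.
apply/eqP; rewrite eq_le; apply/andP; split.
  apply: ge_sup; first by exists `|f c|; exists c.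
  by move=> _ [t tT <-]; exact: cmax.
apply: ub_le_sup; last by exists c.
by exists `|f c| => _ [t tT <-]; exact: cmax.
Qed.

Lemma dyadic_max_cvg :
  dyadic_max m @[m --> \oo] --> sup [set `|f t| | t in `[0, T]].
Proof.
have [c cT [-> cmax]] := sup_norm_attained.
have max_le m : dyadic_max m <= `|f c|.
  apply: bigmax_le => // i _; apply: cmax.
  by rewrite in_itv/= dyadic_ge0/= -[leRHS](dyadic_last m) dyadic_le// -ltnS.
have fc : f @ within `[0, T] (nbhs c) --> f c.
  by move/subspace_continuousP : cf; apply.
apply/cvgrPdist_le => e e0.
move/cvgrPdist_le : fc => /(_ _ e0) [del /= del0 hdel].
have [N _ hN] : \forall n \near \oo, T / del < n%:R by exact: nbhs_infty_gtr.
exists N => // m /= Nm.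
have [i im ci] := dyadic_near m cT.
have dT : `|c - dyadic m i| < del.
  apply: (le_lt_trans ci); rewrite ltr_pdivrMr// mulrC -ltr_pdivrMr//.
  apply: (lt_le_trans (hN m Nm)); rewrite ler_nat ltnW// ltn_expl//.
have := hdel (dyadic m i) dT.
have iT : `[0, T]%classic (dyadic m i).
  by rewrite /= in_itv/= dyadic_ge0/= -[leRHS](dyadic_last m) dyadic_le.
move=> /(_ iT) h; rewrite ger0_norm ?subr_ge0//.
have := le_dyadic_max im; have := ler_normB (f c - f (dyadic m i)) (- f (dyadic m i)).
rewrite opprK subrK normrN; lra.
Qed.

End dyadic_maximum.

Section fbm_supremum.
Context d (Omega : measurableType d) (R : realType) (P : probability Omega R).
Variables (H T g : R) (B : R -> {RV P >-> R}).
Hypotheses (H_gt0 : 0 < H) (T_gt0 : 0 < T) (g_gt0 : 0 < g).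
Hypothesis fbmB : fractional_brownian_motion H B.

Let M m w := dyadic_max T (fun t => B t w) m.
Let S w := sup [set `|B t w| | t in `[0, T]].

Let cB w : {within `[0, T], continuous (fun t : R => B t w)}.
Proof.
have sub : (`[0, T]%classic : set R) `<=` `[0, +oo[%classic.
  by move=> t /=; rewrite !in_itv/= => /andP[-> _].
exact: continuous_subspaceW sub (@fbm_continuous _ _ _ _ _ _ fbmB w).
Qed.

Let mB t : measurable_fun setT (B t).
Proof. exact: measurable_funPT. Qed.

Let mM m : measurable_fun setT (M m).
Proof. exact: (@measurable_max_norm _ _ _ (2 ^ m) (fun i w => B (dyadic T m i) w)). Qed.

Let M_ge0 m w : 0 <= M m w. Proof. exact: dyadic_max_ge0. Qed.

Let S_ge0 w : 0 <= S w.
Proof. by have [c _ [+ _]] := sup_norm_attained T_gt0 (@cB w); rewrite /S => ->. Qed.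

Lemma dyadic_moment_cvg :
  (\int[P]_w (M m w `^ g)%:E @[m --> \oo] --> \int[P]_w (S w `^ g)%:E)%E.
Proof.
have mMg m : measurable_fun setT (fun w => (M m w `^ g)%:E).
  by apply/measurable_EFinP; exact: measurable_powR_fun.
have Mg0 m w : setT w -> (0 <= (M m w `^ g)%:E)%E.
  by move=> _; rewrite lee_fin powR_ge0.
have Mnd w : setT w -> nondecreasing_seq (fun m => (M m w `^ g)%:E).
  move=> _ m n mn; rewrite lee_fin; apply: ge0_ler_powR; rewrite ?nnegrE//.
    exact: ltW.
  exact: dyadic_max_nondecreasing.
have := cvg_monotone_convergence measurableT mMg Mg0 Mnd.
have -> // : (fun w => limn (fun m => (M m w `^ g)%:E)) = (fun w => (S w `^ g)%:E).
apply/funext => w; apply/cvg_lim => //; apply: cvg_EFin.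
  by near=> m.
have := @continuous_norm_powR R g g_gt0 (S w).
have := dyadic_max_cvg T_gt0 (@cB w); rewrite -/(S w) => hM hp.
have h : (fun m => `|M m w| `^ g) @ \oo --> `|S w| `^ g by exact: continuous_cvg hp hM.
have E : (fun m => `|M m w| `^ g) = (fun m => M m w `^ g).
  by apply/funext => m; rewrite ger0_norm.
by rewrite E ger0_norm in h.
Unshelve. all: by end_near. Qed.

(** The walk to compare with has steps of variance t_(k+1)^(2H) - t_k^(2H), so that its
    variances telescope to those of B. *)
Lemma dyadic_moment_le m (l : R) : 1 / 2 <= H -> 1 < l ->
  (\int[P]_w (M m w `^ g)%:E <= 2%:E * \int[P]_w ((l * `|B T w|) `^ g)%:E)%E.
Proof.
move=> H2 l1; pose t (i : nat) := dyadic T m i.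
pose sigma k := Num.sqrt (t k.+1 `^ (2 * H) - t k `^ (2 * H)).
have t0 i : 0 <= t i by exact: dyadic_ge0.
have H20 : 0 <= 2 * H by rewrite mulr_ge0// ltW.
have tle i j : (i <= j)%N -> t i `^ (2 * H) <= t j `^ (2 * H).
  by move=> ij; apply: ge0_ler_powR; rewrite ?nnegrE// dyadic_le.
have walkE i j : walk_cov sigma i j = t (minn i j) `^ (2 * H).
  rewrite /walk_cov; elim: (minn i j) => [|k IH].
    by rewrite big_ord0 /t dyadic0 powR0// mulf_neq0// gt_eqF.
  rewrite big_ord_recr/= IH sqr_sqrtr ?subr_ge0 ?tle//; ring.
have -> : B T = B (t (2 ^ m)%N) by rewrite /t dyadic_last.
have gX := fbm_gauss_vec fbmB (fun i : 'I_(2 ^ m).+1 => t0 i).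
have diag (i : 'I_(2 ^ m).+1) : cov B (t i) (t i) = walk_cov sigma i i.
  by rewrite walkE minnn (fbm_cov_diag fbmB).
have off (i j : 'I_(2 ^ m).+1) : i != j -> walk_cov sigma i j <= cov B (t i) (t j).
  move=> _; rewrite walkE; have [ij|ji] := leqP i j.
    by apply: (fbm_cov_ge H_gt0 fbmB) => //; exact: dyadic_le.
  by rewrite covC; apply: (fbm_cov_ge H_gt0 fbmB) => //; apply: dyadic_le => //; exact: ltnW.
exact: (gauss_max_moment (X := fun i w => B (t i) w) gX (fun i => mB _) diag off g_gt0 l1).
Qed.

Let I := T `^ (g * H) * (1 / Num.sqrt pi * 2 `^ (g / 2) * Gamma ((g + 1) / 2)).

Let end_moment : (\int[P]_w (`|B T w| `^ g)%:E = I%:E)%E.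
Proof. by rewrite /I (fbm_norm_moment fbmB (ltW T_gt0) g_gt0). Qed.

Lemma sup_momentE : sup_moment B T g = (\int[P]_w (S w `^ g)%:E)%E.
Proof. by rewrite /sup_moment expectation.unlock. Qed.

Lemma sup_moment_ge : (I%:E <= sup_moment B T g)%E.
Proof.
rewrite sup_momentE; apply: cvge_ge dyadic_moment_cvg.
apply: nearW => m; rewrite -end_moment; apply: ge0_le_integral => //.
- by apply/measurable_EFinP; apply: measurable_powR_fun; exact: measurableT_comp.
- by apply/measurable_EFinP; exact: measurable_powR_fun.
move=> w _; rewrite lee_fin; apply: ge0_ler_powR; rewrite ?nnegrE ?(ltW g_gt0)//.
exact: dyadic_max_ge_last.
Qed.

(** Let l decrease to 1 in the moment inequality, on each grid. *)
Lemma sup_moment_le : 1 / 2 <= H -> (sup_moment B T g <= (2 * I)%:E)%E.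
Proof.
move=> H2; rewrite sup_momentE; apply: cvge_le dyadic_moment_cvg.
apply: nearW => m; apply/lee_addgt0Pr => e e0.
have I0 : 0 <= I.
  rewrite -lee_fin -end_moment; apply: integral_ge0 => w _.
  by rewrite lee_fin powR_ge0.
(* c = l^g, chosen such that 2 c I <= 2 I + e. *)
pose c := 1 + e / (2 * I + 1).
have c1 : 1 < c by rewrite ltrDl divr_gt0//; lra.
have l1 : 1 < c `^ g^-1.
  have <- : (1 : R) `^ g^-1 = 1 by rewrite powR1.
  apply: gt0_ltr_powR => //; rewrite ?invr_gt0 ?nnegrE//.
  exact: ltW (lt_trans ltr01 c1).
have := dyadic_moment_le m H2 l1.
under [X in (_ <= _ * X)%E -> _]eq_integral => w _ do
   rewrite powRM ?powR_ge0// -powRrM mulVf ?gt_eqF// powRr1 ?(le_trans ler01 (ltW c1))// EFinM.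
rewrite ge0_integralZl//; first last.
- by rewrite lee_fin (le_trans ler01)// ltW.
- by apply/measurable_EFinP; apply: measurable_powR_fun; exact: measurableT_comp.
rewrite end_moment -!EFinM => /le_trans; apply; rewrite -EFinD lee_fin.
have -> : 2 * (c * I) = 2 * I + e * (2 * I / (2 * I + 1)).
  by rewrite /c; field; rewrite gt_eqF//; lra.
rewrite lerD2l ler_piMr ?(ltW e0)// ler_pdivrMr; lra.
Qed.

End fbm_supremum.

Theorem theorem1p1 (R : realType) (gamma T : R) (gamma_gt0 : 0 < gamma)
    (T_gt0 : 0 < T) (H : R) (H_gt0 : 0 < H) (H_le1 : H <= 1)
    (d : measure_display) (Omega : measurableType d) (P : probability Omega R)
    (B : R -> {RV P >-> R}) (fbmB : fractional_brownian_motion H B) :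
  (H < 1 / 2 ->
    ((T `^ (gamma * H) * (1 / Num.sqrt pi) * 2 `^ (gamma / 2)
        * Gamma ((gamma + 1) / 2))%:E
      <= sup_moment B T gamma)%E) /\
  (1 / 2 <= H ->
    ((T `^ (gamma * H) * (1 / Num.sqrt pi) * 2 `^ (gamma / 2)
        * Gamma ((gamma + 1) / 2))%:E
      <= sup_moment B T gamma)%E /\
    (sup_moment B T gamma
      <= (T `^ (gamma * H) * (1 / Num.sqrt pi) * 2 `^ (gamma / 2 + 1)
        * Gamma ((gamma + 1) / 2))%:E)%E).
Proof.
have lower : ((T `^ (gamma * H) * (1 / Num.sqrt pi) * 2 `^ (gamma / 2)
    * Gamma ((gamma + 1) / 2))%:E <= sup_moment B T gamma)%E.
  by have := sup_moment_ge T_gt0 gamma_gt0 fbmB; rewrite !mulrA.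
split=> // H2; split=> //.
apply: le_trans (sup_moment_le H_gt0 T_gt0 gamma_gt0 fbmB H2) _.
have two0 : (2 : R) != 0 by [].
rewrite powRD ?two0 ?implybT// powRr1// lee_fin le_eqVlt; apply/orP; left.
by apply/eqP; ring.
Qed.
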